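(* Let $M$ be in $\mathsf{D}^{\mathrm{c}}(R)$. (i) If $R$ has $\sup R < \infty$, then $$\operatorname{pcd} M = \sup M - \sup R.$$ (ii) If $\sup M < \infty$ and $k$ is in $\mathsf{D}^{\mathrm{c}}(R)$, then $$\operatorname{pcd} M = \sup M + \operatorname{pcd} k.$$
   Context: $k$ is a field and $R$ is a cochain Differential Graded (DG) algebra over $k$ (cohomologically graded) of the form $\cdots \to 0 \to k \to 0 \to R^2 \to R^3 \to \cdots$, i.e. $R^j = 0$ for $j<0$, $R^0 = k$, $R^1 = 0$, with $\dim_k \mathrm{H}^j(R) < \infty$ for each $j$. $\mathsf{D}(R)$ is the derived category of DG left-$R$-modules, and $\otimes^{\mathrm{L}}_R$ is the left derived tensor product. $k$ is viewed as a DG bi-$R$-module concentrated in degree $0$. A DG left-$R$-module is in $\mathsf{D}^{\mathrm{c}}(R)$ (compact) precisely if it is finitely built from $R$ in $\mathsf{D}(R)$ using distinguished triangles, (de)suspensions, finite direct sums and direct summands. For a DG module (or complex) $N$: $\sup N = \sup\{ j \mid \mathrm{H}^j(N)\neq 0\}$, with the convention $\sup\varnothing = -\infty$. The projective codimension of a DG left-$R$-module $M$ is $\operatorname{pcd} M = \sup(k \otimes^{\mathrm{L}}_R M)$. *)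

(* Defs.v *)
From HB Require Import structures.
From mathcomp Require Import all_boot all_order all_algebra.
From mathcomp Require Import mathcomp_extra boolp classical_sets constructive_ereal.
From Stdlib Require Import Relation_Operators ClassicalEpsilon.

Set Implicit Arguments.
Unset Strict Implicit.
Unset Printing Implicit Defensive.
Import Order.TTheory GRing.Theory Num.Theory.
Local Open Scope ring_scope.
#[local] Obligation Tactic := idtac.

(* Operations that shift degrees carry a proof of the degree equation
   (d : C^i -> C^j for i + 1 = j, R^i x M^j -> M^l for i + j = l), which
   avoids transporting elements along equalities of degrees. *)

Record complex (k : fieldType) := Complex {
  cx_obj :> int -> lmodType k;
  cx_d : forall i j : int, i + 1 = j -> cx_obj i -> cx_obj j;
  cx_d_lin : forall i j (h : i + 1 = j), linear (cx_d h);
  cx_dd : forall i j l (h : i + 1 = j) (h' : j + 1 = l) x,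
    cx_d h' (cx_d h x) = 0 }.

Section Complexes.
Variable k : fieldType.
Implicit Type C : complex k.

Definition cocycle C j (x : C j) := forall l (h : j + 1 = l), cx_d h x = 0.

Definition coboundary C j (x : C j) :=
  exists i (h : i + 1 = j) (y : C i), cx_d h y = x.

Definition cohom_nonzero C j := exists2 x : C j, cocycle x & ~ coboundary x.

Definition cohom_findim C j :=
  exists n (b : 'I_n -> C j), (forall i, cocycle (b i)) /\
    forall x : C j, cocycle x ->
      exists c : 'I_n -> k, coboundary (x - \sum_(i < n) c i *: b i).

(* supremum taken in Z with -oo and +oo added; it is -oo on the empty set *)
Definition cx_sup C : \bar int :=
  supremum (-oo)%E [set t | exists2 j : int, cohom_nonzero C j & t = j%:E]%classic.

End Complexes.

Definition sgn (k : fieldType) (i : int) : k := (-1) ^ i.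

Record dgAlg (k : fieldType) := DGAlg {
  dga_cx :> complex k;
  dga_mul : forall i j l : int, i + j = l -> dga_cx i -> dga_cx j -> dga_cx l;
  dga_one : dga_cx 0;
  dga_mul_linl : forall i j l (h : i + j = l) b, linear (fun a => dga_mul h a b);
  dga_mul_linr : forall i j l (h : i + j = l) a, linear (dga_mul h a);
  dga_mulA : forall a b c ab bc abc (hl : a + b = ab) (hl' : ab + c = abc)
      (hr : b + c = bc) (hr' : a + bc = abc) x y z,
    dga_mul hl' (dga_mul hl x y) z = dga_mul hr' x (dga_mul hr y z);
  dga_mul1l : forall j (h : 0 + j = j) x, dga_mul h dga_one x = x;
  dga_mul1r : forall j (h : j + 0 = j) x, dga_mul h x dga_one = x;
  dga_leibniz : forall i j l i' j' l' (h : i + j = l) (hi : i + 1 = i')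
      (hj : j + 1 = j') (hl : l + 1 = l') (h1 : i' + j = l') (h2 : i + j' = l') x y,
    cx_d hl (dga_mul h x y) =
      dga_mul h1 (cx_d hi x) y + sgn k i *: dga_mul h2 x (cx_d hj y) }.

(* DG left modules *)
Record dgmod (k : fieldType) (R : dgAlg k) := DGMod {
  dgm_cx :> complex k;
  dgm_act : forall i j l : int, i + j = l -> R i -> dgm_cx j -> dgm_cx l;
  dgm_act_linl : forall i j l (h : i + j = l) m, linear (fun r => dgm_act h r m);
  dgm_act_linr : forall i j l (h : i + j = l) r, linear (dgm_act h r);
  dgm_actA : forall a b c ab bc abc (hl : a + b = ab) (hl' : ab + c = abc)
      (hr : b + c = bc) (hr' : a + bc = abc) x y m,
    dgm_act hl' (dga_mul hl x y) m = dgm_act hr' x (dgm_act hr y m);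
  dgm_act1 : forall j (h : 0 + j = j) m, dgm_act h (dga_one R) m = m;
  dgm_leibniz : forall i j l i' j' l' (h : i + j = l) (hi : i + 1 = i')
      (hj : j + 1 = j') (hl : l + 1 = l') (h1 : i' + j = l') (h2 : i + j' = l') r m,
    cx_d hl (dgm_act h r m) =
      dgm_act h1 (cx_d hi r) m + sgn k i *: dgm_act h2 r (cx_d hj m) }.

(* DG right modules *)
Record rdgmod (k : fieldType) (R : dgAlg k) := RDGMod {
  rdgm_cx :> complex k;
  rdgm_act : forall i j l : int, i + j = l -> rdgm_cx i -> R j -> rdgm_cx l;
  rdgm_act_linl : forall i j l (h : i + j = l) r, linear (fun m => rdgm_act h m r);
  rdgm_act_linr : forall i j l (h : i + j = l) m, linear (rdgm_act h m);
  rdgm_actA : forall a b c ab bc abc (hl : a + b = ab) (hl' : ab + c = abc)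
      (hr : b + c = bc) (hr' : a + bc = abc) m x y,
    rdgm_act hl' (rdgm_act hl m x) y = rdgm_act hr' m (dga_mul hr x y);
  rdgm_act1 : forall j (h : j + 0 = j) m, rdgm_act h m (dga_one R) = m;
  rdgm_leibniz : forall i j l i' j' l' (h : i + j = l) (hi : i + 1 = i')
      (hj : j + 1 = j') (hl : l + 1 = l') (h1 : i' + j = l') (h2 : i + j' = l') m r,
    cx_d hl (rdgm_act h m r) =
      rdgm_act h1 (cx_d hi m) r + sgn k i *: rdgm_act h2 m (cx_d hj r) }.

Lemma sgn0 (k : fieldType) : sgn k 0 = 1. Proof. exact: expr0z. Qed.

Lemma sgnD (k : fieldType) i j l : i + j = l -> sgn k l = sgn k i * sgn k j.
Proof. by move<-; rewrite /sgn exprzDr // unitrN1. Qed.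

Lemma sgnS (k : fieldType) i j : i + 1 = j -> sgn k j = - sgn k i.
Proof. by move/sgnD->; rewrite /sgn expr1z mulrN1. Qed.

Lemma degS (i j : int) : i + 1 = j -> i + 1 + 1 = j + 1.
Proof. by move<-. Qed.

Lemma degAS (i j l : int) : i + j = l -> i + (j + 1) = l + 1.
Proof. by move<-; rewrite addrA. Qed.

Section LinearFacts.
Variables (k : fieldType) (U V : lmodType k) (f : U -> V) (Hf : linear f).
Lemma lin0 : f 0 = 0.
Proof. by have := Hf (-1) 0 0; rewrite addr0 scaleN1r oppr0 scaleN1r addNr. Qed.
Lemma linD x y : f (x + y) = f x + f y.
Proof. by have := Hf 1 x y; rewrite !scale1r. Qed.
Lemma linZ c x : f (c *: x) = c *: f x.
Proof. by have := Hf c x 0; rewrite !addr0 lin0 addr0. Qed.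
Lemma linN x : f (- x) = - f x.
Proof. by rewrite -scaleN1r linZ scaleN1r. Qed.
End LinearFacts.

Section Modules.
Variables (k : fieldType) (R : dgAlg k).
Implicit Types M N P A : dgmod R.

Record dgmor M N := DGMor {
  mor_fun :> forall j, M j -> N j;
  mor_lin : forall j, linear (@mor_fun j);
  mor_d : forall i j (h : i + 1 = j) x,
    mor_fun (cx_d h x) = cx_d h (mor_fun x);
  mor_act : forall i j l (h : i + j = l) r x,
    mor_fun (dgm_act h r x) = dgm_act h r (mor_fun x) }.

Definition quasi_iso M N (f : dgmor M N) := forall j,
  (forall x : M j, cocycle x -> coboundary (f j x) -> coboundary x) /\
  (forall y : N j, cocycle y ->
     exists2 x : M j, cocycle x & coboundary (y - f j x)).

(* M and N are isomorphic in the derived category, the localization of DG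
   modules at quasi-isomorphisms: zigzags of quasi-isomorphisms. *)
Definition D_iso : dgmod R -> dgmod R -> Prop :=
  clos_refl_sym_trans _ (fun M N => exists f : dgmor M N, quasi_iso f).

Definition regular : dgmod R :=
  DGMod (@dga_mul_linl _ R) (@dga_mul_linr _ R) (@dga_mulA _ R)
    (@dga_mul1l _ R) (@dga_leibniz _ R).

Program Definition zero_cx : complex k :=
  @Complex k (fun=> 'rV[k]_0) (fun _ _ _ _ => 0) _ _.
Next Obligation. by move=> i j h c x y /=; rewrite scaler0 addr0. Qed.
Next Obligation. by []. Qed.

Program Definition zero_mod : dgmod R :=
  @DGMod k R zero_cx (fun _ _ _ _ _ _ => 0) _ _ _ _ _.
Next Obligation. by move=> i j l h m c x y; rewrite scaler0 addr0. Qed.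
Next Obligation. by move=> i j l h r c x y; rewrite scaler0 addr0. Qed.
Next Obligation. by []. Qed.
Next Obligation. by move=> j h m; rewrite (thinmx0 m). Qed.
Next Obligation. by move=> *; rewrite scaler0 addr0. Qed.

Section Sum.
Variables M N : dgmod R.
Program Definition sum_cx : complex k :=
  @Complex k (fun j => (M j * N j)%type) (fun i j h x => (cx_d h x.1, cx_d h x.2)) _ _.
Next Obligation. by move=> i j h c x y /=; rewrite !cx_d_lin. Qed.
Next Obligation. by move=> i j l h h' x /=; rewrite !cx_dd. Qed.

Program Definition sum_mod : dgmod R :=
  @DGMod k R sum_cx (fun i j l h r x => (dgm_act h r x.1, dgm_act h r x.2)) _ _ _ _ _.
Next Obligation. by move=> i j l h m c x y /=; congr (_, _); rewrite dgm_act_linl. Qed.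
Next Obligation. by move=> i j l h r c x y /=; congr (_, _); rewrite dgm_act_linr. Qed.
Next Obligation. by move=> a b c ab bc abc hl hl' hr hr' x y m /=; congr (_, _); apply: dgm_actA. Qed.
Next Obligation. by move=> j h [m n] /=; rewrite !dgm_act1. Qed.
Next Obligation. by move=> i j l i' j' l' h hi hj hl h1 h2 r m /=; congr (_, _); apply: dgm_leibniz. Qed.
End Sum.

Section Susp.
Variable M : dgmod R.
Program Definition susp_cx : complex k :=
  @Complex k (fun j => M (j + 1)) (fun i j h x => - cx_d (degS h) x) _ _.
Next Obligation. by move=> i j h c x y /=; rewrite cx_d_lin opprD scalerN. Qed.
Next Obligation. by move=> i j l h h' x /=; rewrite (linN (cx_d_lin _)) cx_dd !oppr0. Qed.

Program Definition susp : dgmod R :=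
  @DGMod k R susp_cx (fun i j l h r x => sgn k i *: dgm_act (degAS h) r x) _ _ _ _ _.
Next Obligation.
by move=> i j l h m c x y /=; rewrite dgm_act_linl scalerDr !scalerA mulrC.
Qed.
Next Obligation.
by move=> i j l h r c x y /=; rewrite dgm_act_linr scalerDr !scalerA mulrC.
Qed.
Next Obligation.
move=> a b c ab bc abc hl hl' hr hr' x y m /=.
rewrite (linZ (dgm_act_linr _ _)) scalerA (sgnD _ hl); congr (_ *: _).
exact: dgm_actA.
Qed.
Next Obligation.
move=> j h m /=.
rewrite sgn0 scale1r; move: (degAS h) => {h} h; exact: dgm_act1.
Qed.
Next Obligation.
move=> i j l i' j' l' h hi hj hl h1 h2 r m /=.
rewrite (linZ (cx_d_lin _)) (dgm_leibniz _ hi (degS hj) _ (degAS h1) (degAS h2)).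
rewrite (linN (dgm_act_linr _ _)) (sgnS _ hi) scalerDr opprD.
by rewrite scaleNr !scalerN.
Qed.
End Susp.

Section Cone.
Variables (M N : dgmod R) (f : dgmor M N).
(* f : M^(i+1) -> N^(i+1), with target rewritten as N^j *)
Definition cone_map i j (h : i + 1 = j) (x : M (i + 1)) : N j :=
  ecast j (N j) h (f (i + 1) x).

Lemma cone_map_lin i j (h : i + 1 = j) : linear (cone_map h).
Proof. by case: _ / h => c x y; exact: mor_lin. Qed.

Lemma cone_map_d i j l (h : i + 1 = j) (h' : j + 1 = l) x :
  cone_map h' (cx_d (degS h) x) = cx_d h' (cone_map h x).
Proof. by move: (degS h) => e; subst j l; rewrite /= mor_d (eq_irrelevance e erefl). Qed.

Lemma cone_map_act i j l j' l' (h : i + j = l) (hj : j + 1 = j') (hl : l + 1 = l')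
    (h2 : i + j' = l') (h3 : i + (j + 1) = l + 1) r x :
  cone_map hl (dgm_act h3 r x) = dgm_act h2 r (cone_map hj x).
Proof.
move: h3; case: _ / hj h2 x => h2 x; case: _ / hl h2 => h2 h3 /=.
by rewrite (eq_irrelevance h3 h2) -mor_act.
Qed.

Program Definition cone_cx : complex k :=
  @Complex k (fun j => (M (j + 1)%R * N j)%type)
    (fun i j h x => (- cx_d (degS h) x.1, cone_map h x.1 + cx_d h x.2)) _ _.
Next Obligation.
move=> i j h c x y /=; congr (_, _) => /=; first by rewrite cx_d_lin opprD scalerN.
by rewrite cone_map_lin cx_d_lin scalerDr addrACA.
Qed.
Next Obligation.
move=> i j l h h' x /=.
rewrite (linN (cx_d_lin _)) cx_dd !oppr0 (linN (cone_map_lin _)).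
by rewrite (linD (cx_d_lin _)) cx_dd addr0 (cone_map_d h h') addNr.
Qed.

Program Definition cone : dgmod R :=
  @DGMod k R cone_cx
    (fun i j l h r x => (sgn k i *: dgm_act (degAS h) r x.1, dgm_act h r x.2)) _ _ _ _ _.
Next Obligation.
move=> i j l h m c x y /=; congr (_, _) => /=; last by rewrite dgm_act_linl.
by rewrite dgm_act_linl scalerDr !scalerA mulrC.
Qed.
Next Obligation.
move=> i j l h r c x y /=; congr (_, _) => /=; last by rewrite dgm_act_linr.
by rewrite dgm_act_linr scalerDr !scalerA mulrC.
Qed.
Next Obligation.
move=> a b c ab bc abc hl hl' hr hr' x y m /=.
congr (_, _); last exact: dgm_actA.
rewrite (linZ (dgm_act_linr _ _)) scalerA (sgnD _ hl); congr (_ *: _).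
exact: dgm_actA.
Qed.
Next Obligation.
move=> j h [m n] /=; rewrite sgn0 scale1r; move: (degAS h) => h'.
by rewrite !dgm_act1.
Qed.
Next Obligation.
move=> i j l i' j' l' h hi hj hl h1 h2 r m.
rewrite [LHS]surjective_pairing [RHS]surjective_pairing; congr (_, _) => /=.
  rewrite (linZ (cx_d_lin _)) (dgm_leibniz _ hi (degS hj) _ (degAS h1) (degAS h2)).
  rewrite (linN (dgm_act_linr _ _)) (sgnS _ hi) scalerDr opprD.
  by rewrite scaleNr !scalerN.
rewrite (linZ (cone_map_lin _)) (cone_map_act h hj hl h2).
rewrite (dgm_leibniz h hi hj hl h1 h2) (linD (dgm_act_linr _ _)).
by rewrite scalerDr addrCA.
Qed.
End Cone.

(* there is a distinguished triangle M -> N -> C -> susp M in the derived category *)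
Definition dist_triangle M N C :=
  exists M' N' (f : dgmor M' N'), [/\ D_iso M M', D_iso N N' & D_iso C (cone f)].

(* Finitely built from R; closure under the other two terms of a triangle
   follows by rotation, using both suspension rules. *)
Inductive Dc : dgmod R -> Prop :=
| Dc_regular : Dc regular
| Dc_iso M N : D_iso M N -> Dc M -> Dc N
| Dc_triangle M N C : dist_triangle M N C -> Dc M -> Dc N -> Dc C
| Dc_susp M : Dc M -> Dc (susp M)
| Dc_desusp M : Dc (susp M) -> Dc M
| Dc_zero : Dc zero_mod
| Dc_sum M N : Dc M -> Dc N -> Dc (sum_mod M N)
| Dc_summand M N : Dc (sum_mod M N) -> Dc M.

Definition null_homotopic P A (f : dgmor P A) :=
  exists s : forall i j : int, j + 1 = i -> P i -> A j,
    [/\ forall i j (h : j + 1 = i), linear (s i j h),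
        forall a i j i' j' (h : j + 1 = i) (h' : j' + 1 = i')
            (hi : a + i = i') (hj : a + j = j') (r : R a) x,
          s i' j' h' (dgm_act hi r x) = sgn k a *: dgm_act hj r (s i j h x)
      & forall i j l (h : i + 1 = j) (h' : j + 1 = l) x,
          f j x = cx_d h (s j i h x) + s l j h' (cx_d h' x)].

Definition acyclic A := forall j, ~ cohom_nonzero A j.

(* every morphism to an acyclic module vanishes in the homotopy category *)
Definition K_projective P := forall A, acyclic A -> forall f : dgmor P A, null_homotopic f.

Section Tensor.
Variables (X : rdgmod R) (P : dgmod R).

(* R-balanced bilinear maps on the pairs X^i x P^j with i + j = l *)
Definition balanced l (W : lmodType k)
    (phi : forall i j : int, i + j = l -> X i -> P j -> W) :=
  [/\ forall i j h p, linear (fun x => phi i j h x p),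
      forall i j h x, linear (phi i j h x)
    & forall i a j ia aj (hx : i + a = ia) (hp : a + j = aj)
          (h : ia + j = l) (h' : i + aj = l) x r p,
        phi ia j h (rdgm_act hx x r) p = phi i aj h' x (dgm_act hp r p)].

(* T is the tensor product of X and P over R *)
Definition is_tensor (T : complex k) :=
  exists tau : forall l i j : int, i + j = l -> X i -> P j -> T l,
    [/\ forall l, balanced (tau l),
        forall i j l i' j' l' (h : i + j = l) (hi : i + 1 = i')
            (hj : j + 1 = j') (hl : l + 1 = l') (h1 : i' + j = l') (h2 : i + j' = l') x p,
          cx_d hl (tau l i j h x p) =
            tau l' i' j h1 (cx_d hi x) p + sgn k i *: tau l' i j' h2 x (cx_d hj p)
      & forall l (W : lmodType k) phi, @balanced l W phi ->
          exists2 g : {linear T l -> W},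
            forall i j h x p, g (tau l i j h x p) = phi i j h x p
          & forall g' : {linear T l -> W},
              (forall i j h x p, g' (tau l i j h x p) = phi i j h x p) -> g' =1 g].
End Tensor.

Definition is_dtensor (X : rdgmod R) M (T : complex k) :=
  exists P (q : dgmor P M), [/\ K_projective P, quasi_iso q & is_tensor X P T].

(* a chosen representative of the derived tensor product *)
Definition dtensor (X : rdgmod R) M : complex k :=
  epsilon (inhabits zero_cx) (is_dtensor X M).

End Modules.

(* The standing assumptions on R; dga_R0 is the identification of R^0 with k *)
Record scDGA (k : fieldType) := ScDGA {
  dga_alg :> dgAlg k;
  dga_neg : forall j, j < 0 -> forall x : dga_alg j, x = 0;
  dga_R1 : forall x : dga_alg 1, x = 0;
  dga_R0 : {linear dga_alg 0 -> k^o};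
  dga_R0_bij : bijective dga_R0;
  dga_R0_one : dga_R0 (dga_one dga_alg) = 1;
  dga_findim : forall j, cohom_findim dga_alg j }.

Section Residue.
Variables (k : fieldType) (R : scDGA k).

Definition aug i : R i -> k :=
  match i return R i -> k with Posz 0 => dga_R0 R | _ => fun=> 0 end.

Lemma augN i (x : R i) : i != 0 -> aug x = 0.
Proof. by case: i x => [[|n]|n]. Qed.

Lemma aug_lin i : linear (@aug i : R i -> k^o).
Proof.
case: i => [[|n]|n] c x y /=; first exact: linearP.
  by rewrite scaler0 addr0.
by rewrite scaler0 addr0.
Qed.

Lemma aug0 i : @aug i 0 = 0. Proof. exact: lin0 (@aug_lin i). Qed.

Lemma aug1 : aug (dga_one R) = 1. Proof. exact: dga_R0_one. Qed.

Arguments aug : simpl never.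

Lemma augK (x : R 0) : x = aug x *: dga_one R.
Proof.
apply: (bij_inj (dga_R0_bij R)); rewrite linearZ /= dga_R0_one.
by rewrite /GRing.scale /= mulr1.
Qed.

Lemma aug_d i j (h : i + 1 = j) (x : R i) : aug (cx_d h x) = 0.
Proof.
have [j0|/augN //] := eqVneq j 0.
have i0 : i < 0 by rewrite -j0 -h ltrDl.
by rewrite (dga_neg i0 x) (lin0 (cx_d_lin h)) aug0.
Qed.

Lemma aug_mul i j l (h : i + j = l) (x : R i) (y : R j) :
  aug (dga_mul h x y) = aug x * aug y.
Proof.
have [i0|i0] := eqVneq i 0.
  subst i; have e : l = j by rewrite add0r in h.
  move: h; rewrite e => h; rewrite {1}[x]augK (linZ (dga_mul_linl h y)) dga_mul1l.
  exact: (linZ (@aug_lin _)).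
rewrite (augN x) // mul0r.
have [l0|/augN //] := eqVneq l 0.
case: (ltgtP i 0) i0 => // hi _.
  by rewrite (dga_neg hi x) (lin0 (dga_mul_linl h y)) aug0.
have hj : j < 0 by rewrite -(ltrD2l i) h l0 addr0.
by rewrite (dga_neg hj y) (lin0 (dga_mul_linr h x)) aug0.
Qed.

(* k concentrated in degree 0: the space of row vectors of length 1 in degree 0,
   of length 0 in the other degrees *)
Definition kdeg (j : int) : lmodType k := 'rV[k]_(j == 0).

Definition kval j (v : kdeg j) : k := \sum_i v 0 i.
Definition kinc j (c : k) : kdeg j := const_mx c.

Lemma kval_lin j : linear (@kval j : kdeg j -> k^o).
Proof.
move=> c x y; rewrite /kval /GRing.scale /= mulr_sumr -big_split /=.
by apply: eq_bigr => i _; rewrite !mxE.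
Qed.

Lemma kinc_lin j : linear (@kinc j : k^o -> kdeg j).
Proof. by move=> c x y; apply/rowP => i; rewrite !mxE. Qed.

Lemma kval_inc j c : kval (kinc j c) = if j == 0 then c else 0.
Proof.
rewrite /kval /kinc; case: (j == 0) => /=; last by rewrite big_ord0.
by rewrite big_ord1 mxE.
Qed.

Lemma kvalK j (v : kdeg j) : kinc j (kval v) = v.
Proof.
rewrite /kinc /kval /kdeg in v *; case: (j == 0) v => /= v; apply/rowP => i; last by case: i.
by rewrite mxE big_ord1 (ord1 i).
Qed.

Lemma kvalN j (v : kdeg j) : j != 0 -> kval v = 0.
Proof. by move=> j0; rewrite -(kvalK v) kval_inc (negbTE j0). Qed.

Program Definition k_cx : complex k := @Complex k kdeg (fun _ _ _ _ => 0) _ _.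
Next Obligation. by move=> i j h c x y /=; rewrite scaler0 addr0. Qed.
Next Obligation. by []. Qed.

Program Definition k_left : dgmod R :=
  @DGMod k R k_cx (fun i j l h r v => kinc l (aug r * kval v)) _ _ _ _ _.
Next Obligation.
by move=> i j l h m c x y /=; rewrite aug_lin mulrDl -kinc_lin /GRing.scale /= mulrA.
Qed.
Next Obligation.
by move=> i j l h r c x y /=; rewrite kval_lin mulrDr -kinc_lin /GRing.scale /= mulrCA.
Qed.
Next Obligation.
move=> a b c ab bc abc hl hl' hr hr' x y m /=.
rewrite aug_mul kval_inc; apply: (congr1 (@kinc abc)).
case: eqP => [_|/eqP bc0]; first by rewrite mulrA.
rewrite mulr0 -mulrA.
have [b0|/augN ->] := eqVneq b 0; last by rewrite mul0r mulr0.
rewrite kvalN ?mulr0 //.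
by apply: contra bc0 => /eqP c0; rewrite -hr b0 c0.
Qed.
Next Obligation. by move=> j h m /=; rewrite aug1 mul1r kvalK. Qed.
Next Obligation.
move=> i j l i' j' l' h hi hj hl h1 h2 r m /=.
by rewrite aug_d mul0r (lin0 (@kval_lin _)) mulr0 (lin0 (@kinc_lin _)) scaler0 addr0.
Qed.

Program Definition k_right : rdgmod R :=
  @RDGMod k R k_cx (fun i j l h v r => kinc l (kval v * aug r)) _ _ _ _ _.
Next Obligation.
by move=> i j l h m c x y /=; rewrite kval_lin mulrDl -kinc_lin /GRing.scale /= mulrA.
Qed.
Next Obligation.
by move=> i j l h r c x y /=; rewrite aug_lin mulrDr -kinc_lin /GRing.scale /= mulrCA.
Qed.
Next Obligation.
move=> a b c ab bc abc hl hl' hr hr' x y m /=.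
rewrite aug_mul kval_inc; apply: (congr1 (@kinc abc)).
case: eqP => [_|/eqP ab0]; first by rewrite mulrA.
rewrite mul0r mulrA.
have [b0|/augN ->] := eqVneq b 0; last by rewrite mulr0 mul0r.
rewrite kvalN ?mul0r //.
by apply: contra ab0 => /eqP a0; rewrite -hl b0 a0.
Qed.
Next Obligation. by move=> j h m /=; rewrite aug1 mulr1 kvalK. Qed.
Next Obligation.
move=> i j l i' j' l' h hi hj hl h1 h2 r m /=.
by rewrite aug_d (lin0 (@kval_lin _)) mul0r mulr0 (lin0 (@kinc_lin _)) scaler0 addr0.
Qed.

Definition pcd (M : dgmod R) : \bar int := cx_sup (dtensor k_right M).

End Residue.

(* Main.v *)
Require Import Defs.
From HB Require Import structures.
From mathcomp Require Import all_boot all_order all_algebra.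
From mathcomp Require Import constructive_ereal.
From mathcomp Require Import mathcomp_extra boolp classical_sets.
From mathcomp Require Import zify.
From Stdlib Require Import Relation_Operators ClassicalEpsilon.

Set Implicit Arguments.
Unset Strict Implicit.
Unset Printing Implicit Defensive.
Import Order.TTheory GRing.Theory Num.Theory.
Local Open Scope ring_scope.
#[local] Obligation Tactic := idtac.

(** Let [R] satisfy [R^0 = k] and [R^1 = 0].

    A compact module [M] has a finite resolution [F -> M], where [F] is built
    from [0] by attaching free generators in nondecreasing degrees
    ([resolve_from_zero]).  It is built from the bottom upwards: if the cone of
    [F -> M] is exact up to degree [n], a cocycle of degree [n + 1] of that
    cone is killed by attaching one generator of degree [n + 1]; as [R^1 = 0]
    this creates nothing new in degrees [<= n + 1] ([attach_kill]), and
    finite-dimensionality of the cohomology makes each degree a finite task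
    ([resolve_step]).  The process stops because of compactness.  A compact [M]
    has no derived morphism to modules exact in degrees [<= N], for some [N]
    ([Dc_small_bounded]); a module [F] with generators in degrees [<= n] has
    that property with [N = n].  Hence for [n >= N] the cone [C] of [F -> M],
    an extension of a suspension of [F] by [M], has no nonzero morphism to
    itself in the derived category, and so is acyclic ([resolve_compact]).

    (i) Let [X] be a right module with finite [sup X] (taken to be [k] or [R]).
    Attaching a generator of degree [d] to [F] puts [X (x) F] in a triangle with
    the copy of [X] shifted so that its top degree is [d + sup X].  If all the
    earlier generators have degree [<= d], the long exact sequence shows that
    the new top degree is [d + sup X].  With [p] the degree of the last
    generator, [sup (X (x) F) = p + sup X].  For [X = k] this reads [pcd M = p],
    and for [X = R] it reads [sup M = p + sup R] ([attach_tensor],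
    [sup_eq_pcd_add]).

    (ii) Put [c = pcd k], and shift [M] so that [sup M = 0].  A finite
    resolution [K] of [k] starts with a generator in degree [0], the others
    having degree [>= 1], so a cocycle of degree [0] of a module [X] exact above
    degree [1] is the image of that generator under a morphism [K -> X]
    ([kill_map]).  Taking cones of such morphisms strips the cohomology of [M]
    from the top, one copy of [k] at a time.  Every copy of [k] in degree [s]
    contributes to [k (x) M] in degrees [<= s + c] only, so that [k (x) M] is
    exact above [c] ([tensor_exact_above]).  A class in degree [c] coming from
    the top cohomology could only be cancelled by what sits one degree lower;
    but, as [R^1 = 0], the classes of degree [-1] can be stripped before those
    of degree [0], after which nothing reaches degree [c - 1] any more
    ([tensor_top_gap], [tensor_top]).

    The value of [k (x) M] does not depend on the chosen resolution, since the
    tensor product of [k] with an acyclic K-projective module is exact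
    ([dtensor_unique]).  *)

(** * Subspaces and generation modulo a subspace *)

Section Span.
Variables (k : fieldType) (V : lmodType k).
Implicit Types (W D : V -> Prop) (s : seq V).

Definition subspace D := D 0 /\ forall c x y, D x -> D y -> D (c *: x + y).

Lemma subspaceD D x y : subspace D -> D x -> D y -> D (x + y).
Proof. by move=> [_ h] dx dy; rewrite -[x]scale1r; apply: h. Qed.

Lemma subspaceZ D c x : subspace D -> D x -> D (c *: x).
Proof. by move=> [d0 h] dx; rewrite -[_ *: _]addr0; apply: h. Qed.

Lemma subspaceB D x y : subspace D -> D x -> D y -> D (x - y).
Proof. by move=> h dx dy; rewrite addrC -scaleN1r; apply: h.2. Qed.

(** Linear combinations of the entries of [s] modulo [W]; with [W] the coboundaries
    this expresses finite generation of cohomology without forming quotients. *)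
Fixpoint span W s x : Prop :=
  if s is v :: s' then exists c, span W s' (x - c *: v) else W x.

Lemma span_subspace W s : subspace W -> subspace (span W s).
Proof.
elim: s => //= v s IH sW; have {IH} [IH0 IH1] := IH sW; split.
  by exists 0; rewrite scale0r subr0.
move=> c x y [a ha] [b hb]; exists (c * a + b).
suff -> : c *: x + y - (c * a + b) *: v = c *: (x - a *: v) + (y - b *: v).
  exact: IH1.
by rewrite scalerDl scalerBr scalerA opprD addrACA.
Qed.

Lemma span_base W s x : subspace W -> W x -> span W s x.
Proof.
move=> sW wx; elim: s => //= v s IH.
by exists 0; rewrite scale0r subr0.
Qed.

Lemma span_cat W s1 s2 x : span W (s1 ++ s2) x = span (span W s2) s1 x.
Proof.
by elim: s1 x => //= v s IH x; apply: eq_exists => c; rewrite IH.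
Qed.

Lemma span_mono W W' s x : (forall y, W y -> W' y) -> span W s x -> span W' s x.
Proof. by move=> h; elim: s x => [|v s IH] x //=; [apply: h|case=> c /IH ?; exists c]. Qed.

Lemma span_catl W s1 s2 x : subspace W -> span W s1 x -> span W (s1 ++ s2) x.
Proof. by move=> sW; rewrite span_cat; apply: span_mono => y; apply: span_base. Qed.

Lemma span_catr W s1 s2 x : subspace W -> span W s2 x -> span W (s1 ++ s2) x.
Proof. by move=> sW h; rewrite span_cat; apply: span_base => //; apply: span_subspace. Qed.

(** Finite-dimensionality passes to subspaces.  Induction on [s]: either some
    element of [D] involves the first vector, and it serves to eliminate that
    vector from all the others, or the first vector can be dropped. *)
Lemma subspace_span W D s : subspace W -> subspace D -> (forall x, D x -> span W s x) ->
  exists s', (forall v, v \in s' -> D v) /\ (forall x, D x -> span W s' x).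
Proof.
move=> sW; elim: s D => [|v s IH] D sD hD; first by exists [::].
have sWs := span_subspace s sW.
have [[x0 [c0 [Dx0 c00 hx0]]]|no] :=
    pselect (exists x0 c0, [/\ D x0, c0 != 0 & span W s (x0 - c0 *: v)]).
  have [||s1 [h1 h2]] := IH (fun x => D x /\ span W s x).
  - by split; [split; [exact: sD.1|exact: sWs.1]|
      move=> c x y [? ?] [? ?]; split; [apply: sD.2|apply: sWs.2]].
  - by move=> x [].
  exists (x0 :: s1); split.
    by move=> u; rewrite inE => /orP[/eqP->//|/h1[]].
  move=> x Dx /=; have [c hc] := hD x Dx; exists (c / c0).
  apply: h2; split; first by apply: subspaceB => //; apply: subspaceZ.
  suff -> : x - c / c0 *: x0 = (x - c *: v) - (c / c0) *: (x0 - c0 *: v).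
    by apply: subspaceB => //; apply: subspaceZ.
  by rewrite scalerBr scalerA divfK // opprB addrA addrNK.
apply: IH => // x Dx; have [c hc] := hD x Dx.
have [c0|c0] := eqVneq c 0; first by move: hc; rewrite c0 scale0r subr0.
by case: no; exists x, c.
Qed.

End Span.

Lemma span_map (k : fieldType) (U V : lmodType k) (f : U -> V) (W : U -> Prop)
    (W' : V -> Prop) s x :
  linear f -> (forall x, W x -> W' (f x)) -> span W s x -> span W' (map f s) (f x).
Proof.
move=> lf hW; elim: s x => /= [|v s IH] x; first exact: hW.
case=> c /IH h; exists c.
by rewrite -(linZ lf) -(linN lf) -(linD lf).
Qed.

(** * Exactness, cones and finite generation for complexes *)

Section Complexes.
Variable k : fieldType.
Implicit Types A B C : complex k.

Lemma cxd0 C i j (h : i + 1 = j) : cx_d h (0 : C i) = 0.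
Proof. exact: lin0 (cx_d_lin h). Qed.
Lemma cxdD C i j (h : i + 1 = j) (x y : C i) : cx_d h (x + y) = cx_d h x + cx_d h y.
Proof. exact: linD (cx_d_lin h) _ _. Qed.
Lemma cxdN C i j (h : i + 1 = j) (x : C i) : cx_d h (- x) = - cx_d h x.
Proof. exact: linN (cx_d_lin h) _. Qed.
Lemma cxdZ C i j (h : i + 1 = j) c (x : C i) : cx_d h (c *: x) = c *: cx_d h x.
Proof. exact: linZ (cx_d_lin h) _ _. Qed.

Lemma cxdI C i j (h h' : i + 1 = j) (x : C i) : cx_d h x = cx_d h' x.
Proof. by rewrite (eq_irrelevance h h'). Qed.

Lemma cocycleE C i j (h : i + 1 = j) (x : C i) : cocycle x <-> cx_d h x = 0.
Proof.
split=> [|e l h']; first exact.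
by subst j l.
Qed.

(** A degree has only one predecessor, so a boundary can be looked for in a
    prescribed degree [i] and with a prescribed proof of [i + 1 = j]. *)
Lemma coboundaryE C i j (h : i + 1 = j) (x : C j) :
  coboundary x <-> exists y : C i, cx_d h y = x.
Proof.
split=> [[i' [h' [y <-]]]|[y <-]]; last by exists i, h, y.
have e : i' = i by apply: (addIr 1); rewrite h h'.
by subst i'; exists y; exact: cxdI.
Qed.

Lemma coboundary_d C i j (h : i + 1 = j) (y : C i) : coboundary (cx_d h y).
Proof. by exists i, h, y. Qed.

Lemma cocycle_subspace C j : subspace (@cocycle k C j).
Proof.
split=> [l h|c x y hx hy l h]; first exact: cxd0.
by rewrite cx_d_lin hx hy scaler0 addr0.
Qed.

Lemma coboundary_subspace C j : subspace (@coboundary k C j).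
Proof.
have h : j - 1 + 1 = j by lia.
split=> [|c x y /(coboundaryE h)[x' <-] /(coboundaryE h)[y' <-]].
  by rewrite -(cxd0 _ h); apply: coboundary_d.
by rewrite -(cx_d_lin h); apply: coboundary_d.
Qed.

Definition exact_at C j := forall x : C j, cocycle x -> coboundary x.

Lemma exact_atP C j : exact_at C j <-> ~ cohom_nonzero C j.
Proof.
split=> [e [x cx nx]|n x cx]; first exact/nx/e.
by apply: contrapT => nx; apply: n; exists x.
Qed.

Lemma nexact_atP C j : ~ exact_at C j <-> cohom_nonzero C j.
Proof. by rewrite exact_atP; split=> [/contrapT|h nh] //; apply: nh. Qed.

Lemma exact_at0 C j : (forall x : C j, x = 0) -> exact_at C j.
Proof. by move=> e x _; rewrite (e x); exact: (coboundary_subspace C j).1. Qed.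

Record cx_mor A B := CxMor {
  cx_mor_fun :> forall j, A j -> B j;
  cx_mor_lin : forall j, linear (@cx_mor_fun j);
  cx_mor_d : forall i j (h : i + 1 = j) x, cx_mor_fun (cx_d h x) = cx_d h (cx_mor_fun x) }.

(** Transport along an equality of degrees, needed where a degree such as
    [j + m + n] has to be recognized as [j]. *)
Definition cast C i j (e : i = j) (x : C i) : C j := ecast j (C j) e x.

Lemma cast_id C i (e : i = i) (x : C i) : cast e x = x.
Proof. by rewrite (eq_irrelevance e erefl). Qed.

Lemma cast_lin C i j (e : i = j) : linear (@cast C i j e).
Proof. by subst j. Qed.

Lemma cast_dl C i i' j (e : i = i') (h : i' + 1 = j) (h' : i + 1 = j) (x : C i) :
  cx_d h (cast e x) = cx_d h' x.
Proof. by subst i'; apply: cxdI. Qed.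

Lemma cast_d C i i' j j' (e : i = i') (e' : j = j') (h : i + 1 = j) (h' : i' + 1 = j')
    (x : C i) : cast e' (cx_d h x) = cx_d h' (cast e x).
Proof. by subst i' j'; apply: cxdI. Qed.

Lemma cast_cast C i j l (e : i = j) (e' : j = l) (e'' : i = l) (x : C i) :
  cast e' (cast e x) = cast e'' x.
Proof. by subst j l; rewrite !cast_id. Qed.

Lemma castI C i j (e e' : i = j) (x : C i) : cast e x = cast e' x.
Proof. by rewrite (eq_irrelevance e e'). Qed.

Section ComplexCone.
Variables (A B : complex k) (f : cx_mor A B).

Lemma cx_mor0 j : f j 0 = 0. Proof. exact: lin0 (cx_mor_lin f (j:=j)). Qed.
Lemma cx_morN j x : f j (- x) = - f j x. Proof. exact: linN (cx_mor_lin f (j:=j)) _. Qed.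
Lemma cx_morZ j c x : f j (c *: x) = c *: f j x.
Proof. exact: linZ (cx_mor_lin f (j:=j)) _ _. Qed.

Definition cx_cone_map i j (h : i + 1 = j) (x : A (i + 1)) : B j :=
  ecast j (B j) h (f (i + 1) x).

Lemma cx_cone_map_lin i j (h : i + 1 = j) : linear (cx_cone_map h).
Proof. by case: _ / h => c x y; exact: cx_mor_lin. Qed.

Lemma cx_cone_map_d i j l (h : i + 1 = j) (h' : j + 1 = l) x :
  cx_cone_map h' (cx_d (degS h) x) = cx_d h' (cx_cone_map h x).
Proof. by move: (degS h) => e; subst j l; rewrite /= cx_mor_d (eq_irrelevance e erefl). Qed.

(** The same formulas as for cones of DG modules, so that the underlying complex of
    such a cone has, by conversion, the same cocycles and coboundaries as this one. *)
Program Definition cx_cone : complex k :=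
  @Complex k (fun j => (A (j + 1)%R * B j)%type)
    (fun i j h x => (- cx_d (degS h) x.1, cx_cone_map h x.1 + cx_d h x.2)) _ _.
Next Obligation.
move=> i j h c x y /=; congr (_, _) => /=; first by rewrite cx_d_lin opprD scalerN.
by rewrite cx_cone_map_lin cx_d_lin scalerDr addrACA.
Qed.
Next Obligation.
move=> i j l h h' x /=.
rewrite cxdN cx_dd !oppr0 (linN (cx_cone_map_lin _)).
by rewrite cxdD cx_dd addr0 (cx_cone_map_d h h') addNr.
Qed.

Lemma cx_cone_d i (a : A (i + 1)) (b : B i) :
  cx_d (erefl (i + 1)) ((a, b) : cx_cone i) = (- cx_d erefl a, f _ a + cx_d erefl b).
Proof. by rewrite /=; congr (_, _); rewrite (cxdI _ erefl). Qed.

Lemma cx_cone_cocycle i (a : A (i + 1)) (b : B i) :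
  cocycle ((a, b) : cx_cone i) <-> cocycle a /\ f _ a + cx_d erefl b = 0.
Proof.
rewrite (cocycleE erefl) cx_cone_d (cocycleE erefl); split; last first.
  by case=> -> ->; rewrite oppr0.
by case=> /eqP; rewrite oppr_eq0 => /eqP -> ->.
Qed.

Lemma cx_cone_inr i (b : B i) : cocycle b <-> cocycle ((0, b) : cx_cone i).
Proof.
rewrite cx_cone_cocycle cx_mor0 add0r (cocycleE erefl); split=> [->|[]//].
by split=> //; exact: (cocycle_subspace _ _).1.
Qed.

(** The class of [w] maps to a class of [A], which is trivial; by exactness it
    comes from [B]. *)
Lemma cx_cone_lift i j : i + 1 = j -> exact_at A j -> forall w : cx_cone i, cocycle w ->
  exists2 b : B i, cocycle b & coboundary (w - (0, b)).
Proof.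
move=> hj; subst j; have [m e] : exists m, i = m + 1 by exists (i - 1); lia.
subst i => eA [a b] /cx_cone_cocycle[/eA /(coboundaryE erefl)[a' <-] h].
exists (b + f _ a').
  by apply/(cocycleE erefl); rewrite cxdD -cx_mor_d -h; exact: addrC.
apply/(coboundaryE erefl); exists (- a', 0).
rewrite cx_cone_d cxd0 addr0 cxdN opprK cx_morN.
by congr (_, _); rewrite /= ?subr0 // opprD addNKr.
Qed.

Lemma cx_cone_kills j (a : A j) : cocycle a -> coboundary ((0, f j a) : cx_cone j).
Proof.
have [m e] : exists m, j = m + 1 by exists (j - 1); lia.
subst j => /(cocycleE erefl) ca; apply/(coboundaryE erefl); exists (a, 0).
by rewrite cx_cone_d cxd0 addr0 ca oppr0.
Qed.

(** With [les_target] and [les_source], the long exact sequence of the triangle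
    [A -> B -> cone f], in the form of two-out-of-three rules for vanishing. *)
Lemma les_cone_inj i j : i + 1 = j -> exact_at B i ->
  (forall a : A j, cocycle a -> coboundary (f j a) -> coboundary a) ->
  exact_at cx_cone i.
Proof.
move=> hj; subst j; have [m e] : exists m, i = m + 1 by exists (i - 1); lia.
subst i => eB eA [a b] /cx_cone_cocycle[ca h].
have /(coboundaryE erefl)[a' ea] : coboundary a.
  apply: eA => //; apply/(coboundaryE erefl); exists (- b).
  by rewrite cxdN; apply/eqP; rewrite eq_sym -addr_eq0 h.
have /eB /(coboundaryE erefl)[b' e] : cocycle (b + f _ a').
  by apply/(cocycleE erefl); rewrite cxdD -cx_mor_d ea -h; exact: addrC.
apply/(coboundaryE erefl); exists (- a', b').
by rewrite cx_cone_d cx_morN cxdN opprK e ea [- _ + _]addrC addrK.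
Qed.

Lemma les_cone i j : i + 1 = j ->
  exact_at B i -> exact_at A j -> exact_at cx_cone i.
Proof. by move=> h eB eA; apply: (les_cone_inj h eB) => a /eA. Qed.

Lemma les_target j : exact_at A j -> exact_at cx_cone j -> exact_at B j.
Proof.
have [m e] : exists m, j = m + 1 by exists (j - 1); lia.
subst j => eA eC b /cx_cone_inr /eC /(coboundaryE erefl)[[a b']].
rewrite cx_cone_d => -[/eqP]; rewrite oppr_eq0 => /eqP /(cocycleE erefl).
move=> /eA /(coboundaryE erefl)[a' <-] <-.
by rewrite cx_mor_d -cxdD; apply: coboundary_d.
Qed.

Lemma les_source i j : i + 1 = j -> exact_at cx_cone i -> exact_at B j -> exact_at A j.
Proof.
move=> hj; subst j; have [m e] : exists m, i = m + 1 by exists (i - 1); lia.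
subst i => eC eB a ca.
have /eB /(coboundaryE erefl)[b e] : cocycle (f _ a).
  by move=> l h; rewrite -cx_mor_d ca cx_mor0.
have /eC /(coboundaryE erefl)[[a' b']] : cocycle ((a, - b) : cx_cone (m + 1)).
  by apply/cx_cone_cocycle; rewrite cxdN e subrr.
by rewrite cx_cone_d => -[<- _]; rewrite -cxdN; apply: coboundary_d.
Qed.

End ComplexCone.

Definition spans_cohom C j s := (forall v : C j, v \in s -> cocycle v) /\
  forall x : C j, cocycle x -> span (@coboundary k C j) s x.

Definition cohom_fg C j := exists s, @spans_cohom C j s.

Lemma cohom_findim_fg C j : cohom_findim C j -> cohom_fg C j.
Proof.
case=> n [b [hb sb]]; exists (map b (enum 'I_n)); split.
  by move=> v /mapP[i _ ->].
move=> x /sb[c hc]; move: hc; rewrite -big_enum /=.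
elim: (enum _) x => [|i s IH] x; first by rewrite big_nil subr0.
by rewrite big_cons opprD addrA => /IH ?; exists (c i).
Qed.

Lemma spans_cohom_drop C j (z : C j) s :
  coboundary z -> spans_cohom (z :: s) -> spans_cohom s.
Proof.
move=> bz [cs hs]; split=> [v vs|x /hs[c hc]]; first by apply: cs; rewrite inE vs orbT.
have sC := coboundary_subspace C j; rewrite -[x](subrK (c *: z)).
by apply: (subspaceD (span_subspace _ sC) hc); apply: (span_base _ sC); apply: subspaceZ.
Qed.

Lemma exact_cohom_fg C j : exact_at C j -> cohom_fg C j.
Proof. by move=> e; exists [::]. Qed.

(** The cohomology of the cone is an extension of a subspace of that of [A], by a
    quotient of that of [B]. *)
Lemma cohom_fg_cone A B (f : cx_mor A B) i j : i + 1 = j ->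
  cohom_fg B i -> cohom_fg A j -> cohom_fg (cx_cone f) i.
Proof.
move=> hj; subst j; have [m e] : exists m, i = m + 1 by exists (i - 1); lia.
subst i => -[sB [cB hB]] [sA [cA hA]].
pose D a := exists b, cocycle ((a, b) : cx_cone f (m + 1)).
have [||s0 [Ds0 hs0]] := @subspace_span _ _ (@coboundary k A _) D sA (coboundary_subspace _ _).
- split; first by exists 0; exact: (cocycle_subspace _ _).1.
  move=> c x y [b hb] [b' hb']; exists (c *: b + b').
  exact: ((cocycle_subspace (cx_cone f) (m + 1)).2 c _ _ hb hb').
- by move=> a [b /cx_cone_cocycle[/hA]].
have [L [cL eL]] : exists L : seq (cx_cone f (m + 1)),
    (forall v, v \in L -> cocycle v) /\ map fst L = s0.
  elim: s0 Ds0 {hs0} => [|a s IH] Ds; first by exists [::].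
  have [v vs|L [cL eL]] := IH; first by apply: Ds; rewrite inE vs orbT.
  have [|b hb] := Ds a; first by rewrite inE eqxx.
  exists ((a, b) :: L); split; last by rewrite /= eL.
  by move=> v; rewrite inE => /orP[/eqP->|/cL].
pose inr (b : B (m + 1)) : cx_cone f (m + 1) := (0, b).
have linr : linear inr.
  move=> c x y; congr (_, _); rewrite /=; by rewrite scaler0 addr0.
exists (L ++ map inr sB); split.
  move=> v; rewrite mem_cat => /orP[/cL//|/mapP[b /cB cb ->]].
  by move/cx_cone_inr: cb.
move=> x cx; rewrite span_cat.
have : span (@coboundary k A _) (map fst L) x.1.
  by rewrite eL; apply: hs0; exists x.2; rewrite -surjective_pairing.
elim: L x cx cL {eL} => [|v L IH] x cx cL /=.
  case: x cx => a b cx /= /(coboundaryE erefl)[a' ea].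
  have cb : cocycle (b + f _ a').
    apply/(cocycleE erefl); case/cx_cone_cocycle: cx => _ <-.
    rewrite -ea cxdD -cx_mor_d; exact: addrC.
  have -> : (a, b) = inr (b + f _ a') + cx_d erefl ((- a', 0) : cx_cone f m).
    rewrite cx_cone_d cxd0 addr0 cxdN opprK ea /inr cx_morN.
    by congr (_, _) => /=; rewrite ?add0r ?addrK.
  have sC := coboundary_subspace (cx_cone f) (m + 1).
  apply: (subspaceD (span_subspace _ sC)).
    apply: (span_map linr _ (hB _ cb)) => y /(coboundaryE erefl)[z <-].
    apply/(coboundaryE erefl); exists (0, z).
    by rewrite cx_cone_d cx_mor0 cxd0 oppr0 add0r.
  by apply: (span_base _ sC); apply: coboundary_d.
case=> c hc; exists c; apply: IH.
- apply: (subspaceB (cocycle_subspace _ _) cx).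
  apply: (subspaceZ _ (cocycle_subspace _ _)).
  by apply: cL; rewrite inE eqxx.
- by move=> u uL; apply: cL; rewrite inE uL orbT.
- by [].
Qed.

End Complexes.

(** * Morphisms, homotopies and quasi-isomorphisms *)

Lemma sgnM (k : fieldType) i j : sgn k i * sgn k j = sgn k (i + j).
Proof. by rewrite -(sgnD k (erefl (i + j))). Qed.

Lemma sgn_double (k : fieldType) m : sgn k (m + m) = 1.
Proof. by rewrite -sgnM /sgn -expfzMl ?oppr_eq0 ?oner_eq0 // mulrNN mulr1 exp1rz. Qed.

(** Two degrees of the same parity have the same sign; [m] is half their difference. *)
Lemma sgn_par (k : fieldType) m i j : i = j + m + m -> sgn k i = sgn k j.
Proof. by move->; rewrite -addrA -sgnM sgn_double mulr1. Qed.

Lemma sgnK (k : fieldType) (V : lmodType k) i (x : V) : sgn k i *: (sgn k i *: x) = x.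
Proof. by rewrite scalerA sgnM sgn_double scale1r. Qed.

Lemma sgnN1 (k : fieldType) : sgn k 1 = -1. Proof. exact: expr1z. Qed.

Section Modules.
Variables (k : fieldType) (R : dgAlg k).
Implicit Types M N P A B C : dgmod R.

Section MorFacts.
Variables (M N : dgmod R) (f : dgmor M N).
Lemma mor0 j : f j 0 = 0. Proof. exact: lin0 (mor_lin f (j:=j)). Qed.
Lemma morN j x : f j (- x) = - f j x. Proof. exact: linN (mor_lin f (j:=j)) _. Qed.
Lemma morD j x y : f j (x + y) = f j x + f j y.
Proof. exact: linD (mor_lin f (j:=j)) _ _. Qed.
Lemma morB j x y : f j (x - y) = f j x - f j y.
Proof. by rewrite morD morN. Qed.
Lemma morZ j c x : f j (c *: x) = c *: f j x.
Proof. exact: linZ (mor_lin f (j:=j)) _ _. Qed.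
Lemma mor_cast i j (e : i = j) x : f j (cast e x) = cast e (f i x).
Proof. by subst j. Qed.
Lemma mor_cocycle j x : cocycle x -> cocycle (f j x).
Proof. by move=> cx l h; rewrite -mor_d cx mor0. Qed.
Lemma mor_coboundary j x : coboundary x -> coboundary (f j x).
Proof. by case=> i [h [y <-]]; rewrite mor_d; apply: coboundary_d. Qed.
Definition cx_mor_of : cx_mor M N := CxMor (@mor_lin _ _ _ _ f) (@mor_d _ _ _ _ f).
End MorFacts.

Section ActFacts.
Variable M : dgmod R.
Lemma actI i j l (h h' : i + j = l) r (m : M j) : dgm_act h r m = dgm_act h' r m.
Proof. by rewrite (eq_irrelevance h h'). Qed.
Lemma act0 i j l (h : i + j = l) r : dgm_act h r (0 : M j) = 0.
Proof. exact: lin0 (dgm_act_linr h r). Qed.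
Lemma actN i j l (h : i + j = l) r (m : M j) : dgm_act h r (- m) = - dgm_act h r m.
Proof. exact: linN (dgm_act_linr h r) _. Qed.
Lemma actD i j l (h : i + j = l) r (m m' : M j) :
  dgm_act h r (m + m') = dgm_act h r m + dgm_act h r m'.
Proof. exact: linD (dgm_act_linr h r) _ _. Qed.
Lemma actZ i j l (h : i + j = l) r c (m : M j) :
  dgm_act h r (c *: m) = c *: dgm_act h r m.
Proof. exact: linZ (dgm_act_linr h r) _ _. Qed.
Lemma actZl i j l (h : i + j = l) r c (m : M j) :
  dgm_act h (c *: r) m = c *: dgm_act h r m.
Proof. exact: (linZ (dgm_act_linl h m)). Qed.
Lemma act_castr i j j' l (e : j = j') (h : i + j' = l) (h' : i + j = l) r (m : M j) :
  dgm_act h r (cast e m) = dgm_act h' r m.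
Proof. by subst j'; apply: actI. Qed.
Lemma cast_act i j l l' (e : l = l') (h : i + j = l) (h' : i + j = l') r (m : M j) :
  cast e (dgm_act h r m) = dgm_act h' r m.
Proof. by subst l'; apply: actI. Qed.
Lemma cast_act2 i j j' l l' (e : j = j') (e' : l = l') (h : i + j = l) (h' : i + j' = l')
    r (m : M j) : cast e' (dgm_act h r m) = dgm_act h' r (cast e m).
Proof. by subst j' l'; apply: actI. Qed.
End ActFacts.

Program Definition id_mor M : dgmor M M := @DGMor k R M M (fun j x => x) _ _ _.
Next Obligation. by []. Qed.
Next Obligation. by []. Qed.
Next Obligation. by []. Qed.

Program Definition comp_mor M N P (g : dgmor N P) (f : dgmor M N) : dgmor M P :=
  @DGMor k R M P (fun j x => g j (f j x)) _ _ _.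
Next Obligation. by move=> M N P g f j c x y; rewrite /= !mor_lin. Qed.
Next Obligation. by move=> M N P g f i j h x; rewrite /= !mor_d. Qed.
Next Obligation. by move=> M N P g f i j l h r x; rewrite /= !mor_act. Qed.

Program Definition opp_mor M N (f : dgmor M N) : dgmor M N :=
  @DGMor k R M N (fun j x => - f j x) _ _ _.
Next Obligation. by move=> M N f j c x y; rewrite /= mor_lin opprD scalerN. Qed.
Next Obligation. by move=> M N f i j h x; rewrite /= mor_d cxdN. Qed.
Next Obligation. by move=> M N f i j l h r x; rewrite /= mor_act actN. Qed.

Definition homotopy P A := forall i j : int, j + 1 = i -> P i -> A j.

Definition is_homotopy P A (s : homotopy P A) :=
  (forall i j (h : j + 1 = i), linear (s i j h)) /\
  (forall a i j i' j' (h : j + 1 = i) (h' : j' + 1 = i')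
        (hi : a + i = i') (hj : a + j = j') (r : R a) x,
     s i' j' h' (dgm_act hi r x) = sgn k a *: dgm_act hj r (s i j h x)).

Lemma homotopyI P A (s : homotopy P A) i j (h h' : j + 1 = i) x : s i j h x = s i j h' x.
Proof. by rewrite (eq_irrelevance h h'). Qed.

Definition homotopic P A (f g : dgmor P A) :=
  exists2 s : homotopy P A, is_homotopy s &
    forall i j l (h : i + 1 = j) (h' : j + 1 = l) x,
      f j x - g j x = cx_d h (s j i h x) + s l j h' (cx_d h' x).

Lemma null_homotopicP P A (f : dgmor P A) : null_homotopic f <->
  exists2 s : homotopy P A, is_homotopy s &
    forall i j l (h : i + 1 = j) (h' : j + 1 = l) x,
      f j x = cx_d h (s j i h x) + s l j h' (cx_d h' x).
Proof.
by split=> [[s [h1 h2 h3]]|[s [h1 h2] h3]]; exists s.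
Qed.

Lemma null_eq P A (f g : dgmor P A) : (forall j x, f j x = g j x) ->
  null_homotopic f -> null_homotopic g.
Proof. by move=> e [s [h1 h2 h3]]; exists s; split=> // *; rewrite -e; apply: h3. Qed.

Lemma is_homotopyD P A (s t : homotopy P A) : is_homotopy s -> is_homotopy t ->
  is_homotopy (fun i j h x => s i j h x + t i j h x).
Proof.
move=> [s1 s2] [t1 t2]; split=> [i j h c x y|a i j i' j' h h' hi hj r x].
  by rewrite s1 t1 scalerDr addrACA.
by rewrite (s2 _ _ _ _ _ h _ _ hj) (t2 _ _ _ _ _ h _ _ hj) actD scalerDr.
Qed.

Lemma homotopic_null P A (f g : dgmor P A) :
  homotopic f g -> null_homotopic g -> null_homotopic f.
Proof.
move=> [s hs es] /null_homotopicP[t ht et]; apply/null_homotopicP.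
exists (fun i j h x => s i j h x + t i j h x); first exact: is_homotopyD.
move=> i j l h h' x; rewrite -[LHS](subrK (g j x)) (es _ _ _ h h') (et _ _ _ h h').
by rewrite cxdD addrACA.
Qed.

Lemma null_compl P A B (h : dgmor A B) (f : dgmor P A) :
  null_homotopic f -> null_homotopic (comp_mor h f).
Proof.
move=> /null_homotopicP[s [s1 s2] es]; apply/null_homotopicP.
exists (fun i j e x => h j (s i j e x)); first split.
- by move=> i j e c x y; rewrite s1 mor_lin.
- by move=> a i j i' j' e e' hi hj r x; rewrite (s2 _ _ _ _ _ e _ _ hj) morZ mor_act.
- by move=> i j l e e' x; rewrite /= (es _ _ _ e e') morD mor_d.
Qed.

Lemma null_compr P A B (h : dgmor A B) (f : dgmor P A) :
  null_homotopic h -> null_homotopic (comp_mor h f).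
Proof.
move=> /null_homotopicP[s [s1 s2] es]; apply/null_homotopicP.
exists (fun i j e x => s i j e (f i x)); first split.
- by move=> i j e c x y; rewrite mor_lin s1.
- by move=> a i j i' j' e e' hi hj r x; rewrite mor_act (s2 _ _ _ _ _ e _ _ hj).
- by move=> i j l e e' x; rewrite /= (es _ _ _ e e') mor_d.
Qed.

Lemma homotopic_coboundary P A (f g : dgmor P A) j x :
  homotopic f g -> cocycle x -> coboundary (f j x - g j x).
Proof.
move=> [s [s1 _] es] cx; have h : j - 1 + 1 = j by lia.
rewrite (es _ _ _ h (erefl (j + 1))) cx (lin0 (s1 _ _ _)) addr0.
exact: coboundary_d.
Qed.

Lemma null_coboundary P A (f : dgmor P A) j x :
  null_homotopic f -> cocycle x -> coboundary (f j x).
Proof.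
move=> /null_homotopicP[s [s1 _] es] cx; have h : j - 1 + 1 = j by lia.
rewrite (es _ _ _ h (erefl (j + 1))) cx (lin0 (s1 _ _ _)) addr0.
exact: coboundary_d.
Qed.

Lemma qi_exact M N (f : dgmor M N) j : quasi_iso f -> exact_at M j <-> exact_at N j.
Proof.
move=> qf; have [inj sur] := qf j; split=> e x cx; last first.
  by apply: inj => //; apply: e; apply: mor_cocycle.
have [y /e cy] := sur x cx => hb; rewrite -[x](subrK (f j y)).
by apply: (subspaceD (coboundary_subspace _ _)) => //; apply: mor_coboundary.
Qed.

Lemma qi_cohom_fg M N (f : dgmor M N) j : quasi_iso f -> cohom_fg M j <-> cohom_fg N j.
Proof.
move=> qf; have [inj sur] := qf j.
have sM := coboundary_subspace M j; have sN := coboundary_subspace N j.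
have cM := cocycle_subspace M j; have cN := cocycle_subspace N j.
split=> -[s [cs hs]].
  exists (map (f j) s); split=> [v /mapP[u /cs cu ->]|y cy]; first exact: mor_cocycle.
  have [x /hs sx hb] := sur y cy; rewrite -[y](subrK (f j x)).
  apply: (subspaceD (span_subspace _ sN)); first exact: span_base.
  by apply: span_map sx; [exact: mor_lin|move=> u; exact: mor_coboundary].
have [L [cL hL]] : exists L : seq (M j), (forall v, v \in L -> cocycle v) /\
    forall y, span (@coboundary k N j) s y -> span (@coboundary k N j) (map (f j) L) y.
  elim: s cs {hs} => [|v s IH] cs; first by exists [::].
  have [|L [cL hL]] := IH; first by move=> u us; apply: cs; rewrite inE us orbT.
  have [|x cx hx] := sur v; first by apply: cs; rewrite inE eqxx.
  exists (x :: L); split=> [u|y /= [c hc]].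
    by rewrite inE => /orP[/eqP->|/cL].
  exists c; have -> : y - c *: f j x = (y - c *: v) + c *: (v - f j x).
    by rewrite scalerBr addrA subrK.
  apply: (subspaceD (span_subspace _ sN)); first exact: hL.
  by apply: (span_base _ sN); apply: (subspaceZ _ sN).
exists L; split=> // x cx.
have : span (@coboundary k N j) (map (f j) L) (f j x).
  by apply: hL; apply: hs; apply: mor_cocycle.
elim: L x cx cL {hL} => [|v L IH] x cx cL /=; first exact: inj.
case=> c; rewrite -morZ -morB => h; exists c; apply: IH h.
  apply: (subspaceB cM cx); apply: (subspaceZ _ cM).
  by apply: cL; rewrite inE eqxx.
by move=> u uL; apply: cL; rewrite inE uL orbT.
Qed.

Lemma qi_id M : quasi_iso (id_mor M).
Proof.
move=> j; split=> // y cy; exists y => //=; rewrite subrr.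
exact: (coboundary_subspace _ _).1.
Qed.

Lemma qi_comp M N P (g : dgmor N P) (f : dgmor M N) :
  quasi_iso g -> quasi_iso f -> quasi_iso (comp_mor g f).
Proof.
move=> qg qf j; have [ig sg] := qg j; have [jf sf] := qf j; split=> [x cx /= hx|y cy].
  by apply: jf => //; apply: ig => //; apply: mor_cocycle.
have [z cz hz] := sg y cy; have [x cx hx] := sf z cz; exists x => //=.
have -> : y - g j (f j x) = (y - g j z) + g j (z - f j x) by rewrite morB addrA subrK.
by apply: (subspaceD (coboundary_subspace _ _)) => //; apply: mor_coboundary.
Qed.

Lemma qi_null_exact M N (f : dgmor M N) j :
  quasi_iso f -> null_homotopic f -> exact_at M j.
Proof. by move=> qf nf x cx; apply: (qf j).1 => //; apply: null_coboundary. Qed.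

(** Two-out-of-three, up to homotopy. *)
Lemma qi_left_cancel M N P (p : dgmor M P) (q : dgmor N P) (g : dgmor M N) :
  quasi_iso p -> quasi_iso q -> homotopic p (comp_mor q g) -> quasi_iso g.
Proof.
move=> qp qq hh j; have [ip sp] := qp j; have [iq sq] := qq j.
have sP := coboundary_subspace P j.
split=> [x cx hx|y cy].
  apply: ip => //; rewrite -[p j x](subrK (q j (g j x))).
  by apply: (subspaceD sP); [apply: (homotopic_coboundary hh)|apply: mor_coboundary].
have [x cx hx] := sp (q j y) (mor_cocycle q cy); exists x => //.
apply: iq.
  by apply: (subspaceB (cocycle_subspace _ _)) => //; apply: mor_cocycle.
have -> : q j (y - g j x) = (q j y - p j x) + (p j x - q j (g j x)).
  by rewrite morB addrA subrK.
by apply: (subspaceD sP) => //; apply: (homotopic_coboundary hh).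
Qed.

(** * Shifts *)

Lemma shift_deg n (i j : int) : i + 1 = j -> i + n + 1 = j + n.
Proof. by lia. Qed.

Lemma shift_act_deg n (i j l : int) : i + j = l -> i + (j + n) = l + n.
Proof. by lia. Qed.

Section Shift.
Variables (n : int) (M : dgmod R).
Program Definition shift_cx : complex k :=
  @Complex k (fun j => M (j + n)) (fun i j h x => sgn k n *: cx_d (shift_deg n h) x) _ _.
Next Obligation.
by move=> i j h c x y /=; rewrite cx_d_lin scalerDr !scalerA mulrC.
Qed.
Next Obligation. by move=> i j l h h' x /=; rewrite cxdZ cx_dd !scaler0. Qed.

(** The shift by an arbitrary [n]; unlike [susp] it can be inverted.  The signs
    generalize those of [susp]. *)
Program Definition shift : dgmod R :=
  @DGMod k R shift_cx
    (fun i j l h r x => sgn k (n * i) *: dgm_act (shift_act_deg n h) r x) _ _ _ _ _.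
Next Obligation.
by move=> i j l h m c x y /=; rewrite dgm_act_linl scalerDr !scalerA mulrC.
Qed.
Next Obligation.
by move=> i j l h r c x y /=; rewrite dgm_act_linr scalerDr !scalerA mulrC.
Qed.
Next Obligation.
move=> a b c ab bc abc hl hl' hr hr' x y m /=.
rewrite actZ scalerA sgnM -mulrDr hl; congr (_ *: _).
exact: dgm_actA.
Qed.
Next Obligation.
by move=> j h m /=; rewrite mulr0 sgn0 scale1r dgm_act1.
Qed.
Next Obligation.
move=> i j l i' j' l' h hi hj hl h1 h2 r m /=.
rewrite cxdZ (dgm_leibniz _ hi (shift_deg n hj) _ (shift_act_deg n h1) (shift_act_deg n h2)).
rewrite actZ !scalerDr !scalerA !sgnM; congr (_ *: _ + _ *: _).
  by rewrite -hi mulrDr mulr1 addrC.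
by congr sgn; lia.
Qed.

Lemma shift_cocycle j (x : M (j + n)) : cocycle (x : shift j) <-> cocycle x.
Proof.
rewrite (cocycleE (erefl (j + 1)) (x : shift j)) (cocycleE (shift_deg n (erefl (j + 1)))) /=.
by split=> [e|->]; rewrite ?scaler0 // -[LHS](@sgnK _ _ n) e scaler0.
Qed.

Lemma shift_coboundary j (x : M (j + n)) : coboundary (x : shift j) <-> coboundary x.
Proof.
have h0 : j - 1 + 1 = j by lia.
rewrite (coboundaryE h0 (x : shift j)) (coboundaryE (shift_deg n h0)) /=.
split=> -[y e]; exists (sgn k n *: y); first by rewrite cxdZ e.
by rewrite cxdZ sgnK.
Qed.

Lemma exact_shift j : exact_at shift j <-> exact_at M (j + n).
Proof. by split=> e x /shift_cocycle /e /shift_coboundary. Qed.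

Lemma cohom_fg_shift j : cohom_fg shift j <-> cohom_fg M (j + n).
Proof.
have cb : @coboundary k shift j = @coboundary k M (j + n).
  by apply/funext => x; apply/propext/shift_coboundary.
split=> -[s [cs hs]]; exists s; split; move=> x.
- by move=> /cs /shift_cocycle.
- by move=> /shift_cocycle /hs; rewrite cb.
- by move=> /cs /shift_cocycle.
- by move=> /shift_cocycle /hs; rewrite cb.
Qed.

Lemma cast_shift i j (e : i = j) (e' : i + n = j + n) (x : M (i + n)) :
  cast e (x : shift i) = cast e' x.
Proof. by subst j; rewrite !cast_id. Qed.

End Shift.

Program Definition shift_mor n M N (f : dgmor M N) : dgmor (shift n M) (shift n N) :=
  @DGMor k R (shift n M) (shift n N) (fun j x => f (j + n) x) _ _ _.
Next Obligation. by move=> n M N f j c x y; rewrite mor_lin. Qed.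
Next Obligation. by move=> n M N f i j h x /=; rewrite morZ mor_d. Qed.
Next Obligation. by move=> n M N f i j l h r x /=; rewrite morZ mor_act. Qed.

Lemma null_shift n P A (f : dgmor P A) : null_homotopic f -> null_homotopic (shift_mor n f).
Proof.
move=> /null_homotopicP[s [s1 s2] es]; apply/null_homotopicP.
exists (fun i j (h : j + 1 = i) (x : shift n P i) =>
  sgn k n *: s (i + n) (j + n) (shift_deg n h) x : shift n A j); first split.
- by move=> i j h c x y /=; rewrite s1 scalerDr !scalerA mulrC.
- move=> a i j i' j' h h' hi hj r x /=.
  rewrite (linZ (s1 _ _ _)) (s2 _ _ _ _ _ (shift_deg n h) _ _ (shift_act_deg n hj)).
  rewrite actZ !scalerA; congr (_ *: _).
  by rewrite mulrC mulrA mulrAC.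
- move=> i j l h h' x /=.
  by rewrite cxdZ sgnK (linZ (s1 _ _ _)) sgnK; apply: es.
Qed.

Section ShiftInverse.
Variables (m n : int) (M : dgmod R) (e : n + m = 0).

Lemma unshift_deg j : j + m + n = j. Proof. by lia. Qed.

Lemma sgn_opp i : sgn k (m * i) * sgn k (n * i) = 1.
Proof. by rewrite sgnM -mulrDl [m + n]addrC e mul0r sgn0. Qed.

Lemma sgn_opp1 : sgn k m * sgn k n = 1.
Proof. by rewrite -(sgn_opp 1) !mulr1. Qed.

Program Definition unshift : dgmor (shift m (shift n M)) M :=
  @DGMor k R (shift m (shift n M)) M (fun j x => cast (unshift_deg j) (x : M _)) _ _ _.
Next Obligation. by move=> j c x y; rewrite /= cast_lin. Qed.
Next Obligation.
move=> i j h x /=; rewrite scalerA sgn_opp1 scale1r.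
exact: cast_d.
Qed.
Next Obligation.
move=> i j l h r x /=; rewrite scalerA sgn_opp scale1r; exact: cast_act2.
Qed.

Program Definition reshift : dgmor M (shift m (shift n M)) :=
  @DGMor k R M (shift m (shift n M)) (fun j x => cast (esym (unshift_deg j)) x) _ _ _.
Next Obligation. by move=> j c x y; rewrite /= cast_lin. Qed.
Next Obligation.
move=> i j h x /=; rewrite scalerA sgn_opp1 scale1r; exact: cast_d.
Qed.
Next Obligation.
move=> i j l h r x /=; rewrite scalerA sgn_opp scale1r; exact: cast_act2.
Qed.

Lemma qi_reshift : quasi_iso reshift.
Proof.
move=> j; split=> [x cx|y cy].
  move=> h; have -> : x = unshift _ (reshift _ x) by rewrite /= (cast_cast _ _ erefl).
  exact: mor_coboundary.
exists (unshift _ y); first exact: mor_cocycle.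
by rewrite /= (cast_cast _ _ erefl) /= subrr; exact: (coboundary_subspace _ _).1.
Qed.
End ShiftInverse.

(** A morphism out of [shift m P] is, up to transport, the shift of a morphism out
    of [P]. *)
Lemma unshift_shift_mor m n (e : n + m = 0) (e' : m + n = 0) P A (g : dgmor (shift m P) A) j x :
  unshift A e j (shift_mor m (comp_mor (shift_mor n g) (reshift P e')) j x) = g j x.
Proof.
rewrite /= -(cast_shift (esym (unshift_deg e j))) mor_cast.
exact: (cast_cast _ _ erefl).
Qed.

(** * Cones of DG modules *)

Section Cone.
Variables (M N : dgmod R) (f : dgmor M N).

Lemma cone_cohom_fgE j : cohom_fg (cone f) j = cohom_fg (cx_cone (cx_mor_of f)) j.
Proof. by []. Qed.

Lemma cone_d i (a : M (i + 1)) (b : N i) :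
  cx_d (erefl (i + 1)) ((a, b) : cone f i) = (- cx_d erefl a, f _ a + cx_d erefl b).
Proof. exact: (cx_cone_d (cx_mor_of f)). Qed.

Lemma cone_cocycle i (a : M (i + 1)) (b : N i) :
  cocycle ((a, b) : cone f i) <-> cocycle a /\ f _ a + cx_d erefl b = 0.
Proof. exact: (cx_cone_cocycle (cx_mor_of f)). Qed.

Program Definition cone_in : dgmor N (cone f) :=
  @DGMor k R N (cone f) (fun j y => (0, y)) _ _ _.
Next Obligation. by move=> j c x y; congr (_, _); rewrite /= scaler0 addr0. Qed.
Next Obligation.
move=> i j h x; subst j; rewrite [RHS]cone_d cxd0 oppr0 mor0 add0r.
by congr (_, _); apply: cxdI.
Qed.
Next Obligation.
by move=> i j l h r x /=; congr (_, _); rewrite act0 scaler0.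
Qed.

Program Definition cone_pr : dgmor (cone f) (shift 1 M) :=
  @DGMor k R (cone f) (shift 1 M) (fun j x => x.1) _ _ _.
Next Obligation. by []. Qed.
Next Obligation.
by move=> i j h x /=; rewrite sgnN1 scaleN1r; congr (- _); apply: cxdI.
Qed.
Next Obligation.
by move=> i j l h r x /=; rewrite mul1r; congr (_ *: _); apply: actI.
Qed.

(** Both directions are the long exact sequence of the cone. *)
Lemma qi_cone : quasi_iso f <-> forall j, exact_at (cone f) j.
Proof.
split=> [qf j|e j].
  have [m ej] : exists m, j = m + 1 by exists (j - 1); lia.
  subst j => -[a b] /cone_cocycle[ca eb].
  have [inj _] := qf (m + 1 + 1); have [_ sur] := qf (m + 1).
  have /(coboundaryE erefl)[a' ea] : coboundary a.
    apply: inj => //; apply/(coboundaryE erefl); exists (- b).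
    by rewrite cxdN; apply/eqP; rewrite eq_sym -addr_eq0 eb.
  have [|x cx /(coboundaryE erefl)[b' hb]] := sur (b + f _ a').
    apply/(cocycleE erefl); rewrite cxdD -mor_d ea -eb; exact: addrC.
  apply/(coboundaryE erefl); exists (- (a' - x), b').
  rewrite cone_d hb cxdN opprK cxdD cxdN.
  rewrite ((cocycleE erefl x).1 cx) oppr0 addr0 ea.
  congr (_, _); rewrite /= morN morB; move: (f _ a') (f _ x) => u v.
  by rewrite -[b + u - v]addrA [LHS]addrCA addNr addr0.
have [m ej] : exists m, j = m + 1 + 1 by exists (j - 1 - 1); lia.
subst j; split=> [x cx /(coboundaryE erefl)[b eb]|y cy].
  have /e /(coboundaryE erefl)[[a' b']] : cocycle ((x, - b) : cone f (m + 1)).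
    by apply/cone_cocycle; rewrite cxdN eb subrr.
  by rewrite cone_d => -[<- _]; rewrite -cxdN; apply: coboundary_d.
have /e /(coboundaryE erefl)[[a b]] := mor_cocycle cone_in cy.
rewrite cone_d => -[/eqP]; rewrite oppr_eq0 => /eqP ea <-.
exists a; first exact/(cocycleE erefl).
by rewrite [f _ a + _]addrC addrK; apply: coboundary_d.
Qed.

(** The universal property of the cone: a null-homotopy of [psi \o f] extends
    [psi].  The homotopy is kept explicit, for later computations with the extension. *)
Lemma cone_ext A (psi : dgmor N A) (s : homotopy M A) : is_homotopy s ->
  (forall i j l (h : i + 1 = j) (h' : j + 1 = l) x,
     psi j (f j x) = cx_d h (s j i h x) + s l j h' (cx_d h' x)) ->
  exists psi' : dgmor (cone f) A,
    forall j x y, psi' j (x, y) = psi j y + s (j + 1) j erefl x.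
Proof.
move=> [s1 s2] es.
unshelve eexists (@DGMor k R (cone f) A
  (fun j x => psi j x.2 + s (j + 1) j erefl x.1) _ _ _); last by [].
- by move=> j c x y /=; rewrite mor_lin s1 scalerDr addrACA.
- move=> i j h [x y]; subst j; rewrite /= /cone_map /=.
  rewrite morD (es _ _ _ erefl (degS erefl)) mor_d (linN (s1 _ _ _)) cxdD.
  by rewrite (homotopyI s erefl (degS erefl)) [LHS]addrAC addrK [LHS]addrC.
- move=> i j l h r [x y] /=.
  rewrite mor_act actD (linZ (s1 _ _ _)) (s2 _ _ _ _ _ erefl _ _ h) scalerA sgnM.
  by rewrite sgn_double scale1r.
Qed.

Lemma cone_ext_null A (psi : dgmor N A) : null_homotopic (comp_mor psi f) ->
  exists psi' : dgmor (cone f) A, forall j y, psi' j (0, y) = psi j y.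
Proof.
move=> /null_homotopicP[s hs /(cone_ext hs)[psi' e]]; exists psi' => j y.
by rewrite e (lin0 (hs.1 _ _ _)) addr0.
Qed.

(** Dually, a morphism out of the cone that is null-homotopic on [N] factors up
    to homotopy through the suspension of [M]. *)
Lemma cone_fact A (w : dgmor (cone f) A) : null_homotopic (comp_mor w cone_in) ->
  exists v : dgmor (shift 1 M) A, homotopic w (comp_mor v cone_pr).
Proof.
move=> /null_homotopicP[s [s1 s2] es].
have wE j (x : M (j + 1)) y : w j (x, y) = w j (x, 0) + w j (0, y).
  by rewrite -morD; congr (w j _); congr (_, _) => /=; rewrite ?addr0 ?add0r.
unshelve eexists (@DGMor k R (shift 1 M) A
  (fun j (x : shift 1 M j) => w j ((x, 0) : cone f j) - s (j + 1) j erefl (f (j + 1) x)) _ _ _).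
- move=> j c x y /=; rewrite mor_lin s1 scalerBr opprD addrACA; congr (_ + _).
  by rewrite -mor_lin; congr (w j _); congr (_, _); rewrite /= scaler0 addr0.
- move=> i j h x; subst j; rewrite cxdD cxdN -mor_d cone_d cxd0 addr0.
  rewrite [in RHS]wE [w _ (0, f _ _)](es _ _ _ erefl (erefl (i + 1 + 1))).
  rewrite -mor_d /= sgnN1 scaleN1r (cxdI (shift_deg 1 erefl) erefl) morN (linN (s1 _ _ _)) opprK.
  by rewrite [cx_d _ (s _ _ _ _) + _]addrC -[RHS]addrA addrK.
- move=> i j l h r x; rewrite actD actN -mor_act /=.
  rewrite act0 mul1r (actI (shift_act_deg 1 h) (degAS h)) morZ mor_act (linZ (s1 _ _ _)).
  by rewrite (s2 _ _ _ _ _ erefl _ _ h) sgnK.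
- exists (fun i j h x => s i j h x.2).
    split=> [i j h c x y|a i j i' j' h h' hi hj r x] /=; first by rewrite s1.
    exact: s2.
  move=> i j l h h' [x y]; subst j l; rewrite cone_d /=.
  rewrite wE [w _ (0, y)](es _ _ _ erefl (erefl (i + 1 + 1))) (linD (s1 _ _ _)).
  have aux (p q r t : A (i + 1)) : p + (q + r) + (t - p) = q + (t + r).
    by rewrite [p + _]addrC addrACA subrr addr0 -addrA [r + t]addrC.
  by rewrite opprB; exact: aux.
Qed.
End Cone.

(** * Modules without morphisms to partially exact modules *)

(** With [S] everything this is K-projectivity; with [S] the degrees [<= n], it
    holds for the modules built from free generators of degrees [<= n]. *)
Definition left_orth (S : int -> Prop) P := forall A, (forall j, S j -> exact_at A j) ->
  forall f : dgmor P A, null_homotopic f.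

Lemma left_orth_mono (S S' : int -> Prop) P :
  (forall j, S j -> S' j) -> left_orth S P -> left_orth S' P.
Proof. by move=> h o A eA; apply: o => j /h; apply: eA. Qed.

Lemma left_orth_K_projective S P : left_orth S P -> K_projective P.
Proof. by move=> o A eA; apply: o => j _; apply/exact_atP/eA. Qed.

Lemma K_projectiveP P : K_projective P <-> left_orth (fun _ => True) P.
Proof.
split=> [kp A eA|]; last exact: left_orth_K_projective.
by apply: kp => j; apply/exact_atP/eA.
Qed.

Lemma left_orth_shift S n P : left_orth S P -> left_orth (fun j => S (j + n)) (shift n P).
Proof.
move=> o A eA f.
have e : - n + n = 0 by lia.
have e' : n + - n = 0 by lia.
pose g := comp_mor (shift_mor (- n) f) (reshift P e').
have ng : null_homotopic g.
  by apply: o => j Sj; apply/exact_shift; apply: eA; rewrite subrK.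
apply: null_eq (null_compl (unshift A e) (null_shift n ng)) => j x.
exact: (unshift_shift_mor e e').
Qed.

Lemma left_orth_cone S P Q (f : dgmor P Q) :
  left_orth S Q -> left_orth S (shift 1 P) -> left_orth S (cone f).
Proof.
move=> oQ oP A eA w; have [v hv] := cone_fact (oQ _ eA (comp_mor w (cone_in f))).
by apply: homotopic_null hv _; apply: null_compr; apply: oP.
Qed.

Lemma left_orth_zero S : left_orth S (zero_mod R).
Proof.
move=> A eA f; apply/null_homotopicP; exists (fun _ _ _ _ => 0).
  split=> [i j h c x y|a i j i' j' h h' hi hj r x] /=; last by rewrite act0 scaler0.
  by rewrite scaler0 addr0.
by move=> i j l h h' x; rewrite (thinmx0 x) mor0 cxd0 addr0.
Qed.

(** Lifting of [f] along [q]: the composite of [f] with [B -> cone q] is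
    null-homotopic, and the component in [A] of a null-homotopy is a lift. *)
Lemma left_orth_lift S P A B (q : dgmor A B) (f : dgmor P B) : left_orth S P ->
  (forall j, S j -> exact_at (cone q) j) ->
  exists g : dgmor P A, homotopic f (comp_mor q g).
Proof.
move=> o e; have /null_homotopicP[s [s1 s2] es] := o _ e (comp_mor (cone_in q) f).
have es1 i j l (h : i + 1 = j) (h' : j + 1 = l) x :
    cx_d (degS h) (s j i h x).1 = (s l j h' (cx_d h' x)).1.
  have /= /(congr1 fst) /= := es i j l h h' x.
  by move/esym/eqP; rewrite addr_eq0 eqr_opp => /eqP.
have es2 i j l (h : i + 1 = j) (h' : j + 1 = l) x :
    f j x = cone_map q h (s j i h x).1 + cx_d h (s j i h x).2 + (s l j h' (cx_d h' x)).2.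
  by have /= /(congr1 snd) /= := es i j l h h' x.
have e0 (j : int) : j - 1 + 1 = j by lia.
have sE (i j : int) (h : i + 1 = j) x :
    cast (e0 j) (s j (j - 1) (e0 j) x).1 = cast h (s j i h x).1.
  have ei : i = j - 1 by lia.
  by subst i; rewrite (homotopyI s (e0 j) h) (castI _ h).
unshelve eexists (@DGMor k R P A (fun j x => cast (e0 j) (s j (j - 1) (e0 j) x).1) _ _ _).
- by move=> j c x y; rewrite s1 cast_lin.
- move=> i j h x /=; rewrite (sE _ _ h) -(es1 _ _ _ (e0 i) h); exact: cast_d.
- move=> i j l h r x /=.
  have hj : i + (j - 1) = l - 1 by lia.
  by rewrite (s2 _ _ _ _ _ (e0 j) _ _ hj) /= sgnK; apply: cast_act2.
exists (fun i j h x => (s i j h x).2).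
  split=> [i j h c x y|a i j i' j' h h' hi hj r x]; first by rewrite s1.
  by rewrite (s2 _ _ _ _ _ h _ _ hj).
move=> i j l h h' x; rewrite (es2 _ _ _ h h') /= (sE _ _ h) mor_cast.
by rewrite -[cast h _]/(cone_map q h _) [LHS]addrAC [cone_map _ _ _ + _]addrC addrK.
Qed.

End Modules.

(** * Compact modules: finiteness and vanishing of derived morphisms *)

Section DerivedOrth.
Variables (k : fieldType) (R : dgAlg k).
Implicit Types M N P A B C : dgmod R.

Lemma nullD P A (e f g : dgmor P A) : (forall j x, e j x = f j x + g j x) ->
  null_homotopic f -> null_homotopic g -> null_homotopic e.
Proof.
move=> he /null_homotopicP[s hs es] ng; apply: (homotopic_null (g := g)) => //.
by exists s => // i j l h h' x; rewrite he addrK; apply: es.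
Qed.

Lemma homotopic_compl P A B (h : dgmor A B) (f g : dgmor P A) :
  homotopic f g -> homotopic (comp_mor h f) (comp_mor h g).
Proof.
move=> [s [s1 s2] es]; exists (fun i j e x => h j (s i j e x)); first split.
- by move=> i j e c x y; rewrite s1 mor_lin.
- by move=> a i j i' j' e e' hi hj r x; rewrite (s2 _ _ _ _ _ e _ _ hj) morZ mor_act.
- by move=> i j l e e' x; rewrite /= -morB (es _ _ _ e e') morD mor_d.
Qed.

Lemma null_cone_in M N (f : dgmor M N) : null_homotopic (comp_mor (cone_in f) f).
Proof.
apply/null_homotopicP.
exists (fun i j (h : j + 1 = i) x => (cast (esym h) x, 0) : cone f j); first split.
- by move=> i j h c x y; congr (_, _); rewrite /= ?cast_lin // scaler0 addr0.
- move=> a i j i' j' h h' hi hj r x /=; rewrite act0.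
  congr (_, _) => /=; last by rewrite scaler0.
  by rewrite sgnK; apply: cast_act2.
- move=> i j l h h' x; subst j l; rewrite cone_d /= cxd0 !addr0.
  by congr (_, _); rewrite /= ?addNr ?addr0.
Qed.

(** The long exact sequence, when the third term vanishes. *)
Lemma qi_cone_in M N (f : dgmor M N) : (forall j, exact_at M j) -> quasi_iso (cone_in f).
Proof.
move=> e j; have [m ej] : exists m, j = m + 1 by exists (j - 1); lia.
subst j; split=> [y cy /(coboundaryE erefl)[[m' n']]|[m' n'] /cone_cocycle[]].
  rewrite cone_d => -[/eqP]; rewrite oppr_eq0 => /eqP /(cocycleE erefl) /e.
  by move=> /(coboundaryE erefl)[a <-] <-; rewrite mor_d -cxdD; apply: coboundary_d.
move=> /e /(coboundaryE erefl)[a <-] ea.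
exists (n' + f _ a).
  by apply/(cocycleE erefl); rewrite cxdD -mor_d -ea; exact: addrC.
apply/(coboundaryE erefl); exists (- a, 0).
rewrite cone_d cxd0 addr0 cxdN opprK morN.
by congr (_, _); rewrite /= ?subr0 // opprD addNKr.
Qed.

(** The vanishing, in the derived category, of all morphisms from [M] to modules
    exact in the degrees of [S], expressed by fractions with a quasi-isomorphism at
    the target; it makes sense without a resolution of [M], and is stable under all
    the operations that build compact objects. *)
Definition derived_orth (S : int -> Prop) M := forall A, (forall j, S j -> exact_at A j) ->
  forall f : dgmor M A, exists A' (h : dgmor A A'),
    quasi_iso h /\ null_homotopic (comp_mor h f).

Lemma left_orth_derived S M : left_orth S M -> derived_orth S M.
Proof.
move=> o A /o oA f; exists A, (id_mor A); split; first exact: qi_id.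
by apply: null_eq (oA f).
Qed.

Lemma derived_orth_mono (S S' : int -> Prop) M :
  (forall j, S j -> S' j) -> derived_orth S M -> derived_orth S' M.
Proof. by move=> h o A eA; apply: o => j /h; apply: eA. Qed.

Lemma derived_orth_cone S M N (f : dgmor M N) :
  derived_orth S N -> derived_orth S (shift 1 M) -> derived_orth S (cone f).
Proof.
move=> oN oM A eA w; have [A1 [h [qh nh]]] := oN _ eA (comp_mor w (cone_in f)).
have [|v hv] := @cone_fact _ _ _ _ f A1 (comp_mor h w); first by apply: null_eq nh.
have eA1 j : S j -> exact_at A1 j by move=> /eA; rewrite (qi_exact _ qh).
have [A2 [h2 [qh2 nh2]]] := oM _ eA1 v.
exists A2, (comp_mor h2 h); split; first exact: qi_comp.
have := homotopic_compl h2 hv => /homotopic_null H.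
by apply: null_eq (H _) => //; apply: null_eq (null_compr (cone_pr f) nh2).
Qed.

(** Once [f \o q] is killed by [h], [h \o f] extends to a morphism [psi] from
    the acyclic module [cone q]; passing to [cone psi] costs nothing, and kills it. *)
Lemma derived_orth_qi_target S M M' (q : dgmor M M') :
  quasi_iso q -> derived_orth S M -> derived_orth S M'.
Proof.
move=> qq o A eA f; have [A1 [h [qh nh]]] := o _ eA (comp_mor f q).
have [|psi epsi] := @cone_ext_null _ _ _ _ q A1 (comp_mor h f); first by apply: null_eq nh.
exists (cone psi), (comp_mor (cone_in psi) h); split.
  by apply: qi_comp => //; apply: qi_cone_in; apply/qi_cone.
apply: null_eq (null_compr (cone_in q) (null_cone_in psi)) => j x.
by rewrite /= epsi.
Qed.

Section Sum.
Variables M N : dgmod R.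
Program Definition sum_in1 : dgmor M (sum_mod M N) :=
  @DGMor k R M (sum_mod M N) (fun j x => (x, 0)) _ _ _.
Next Obligation. by move=> j c x y; congr (_, _); rewrite /= scaler0 addr0. Qed.
Next Obligation. by move=> i j h x; congr (_, _); rewrite /= cxd0. Qed.
Next Obligation. by move=> i j l h r x; congr (_, _); rewrite /= act0. Qed.
Program Definition sum_in2 : dgmor N (sum_mod M N) :=
  @DGMor k R N (sum_mod M N) (fun j x => (0, x)) _ _ _.
Next Obligation. by move=> j c x y; congr (_, _); rewrite /= scaler0 addr0. Qed.
Next Obligation. by move=> i j h x; congr (_, _); rewrite /= cxd0. Qed.
Next Obligation. by move=> i j l h r x; congr (_, _); rewrite /= act0. Qed.
Program Definition sum_pr1 : dgmor (sum_mod M N) M :=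
  @DGMor k R (sum_mod M N) M (fun j x => x.1) _ _ _.
Next Obligation. by []. Qed.
Next Obligation. by []. Qed.
Next Obligation. by []. Qed.
Program Definition sum_pr2 : dgmor (sum_mod M N) N :=
  @DGMor k R (sum_mod M N) N (fun j x => x.2) _ _ _.
Next Obligation. by []. Qed.
Next Obligation. by []. Qed.
Next Obligation. by []. Qed.

Lemma sum_split j (x : sum_mod M N j) : x = sum_in1 j (sum_pr1 j x) + sum_in2 j (sum_pr2 j x).
Proof. by case: x => a b; congr (_, _); rewrite /= ?addr0 ?add0r. Qed.

Lemma derived_orth_sum S : derived_orth S M -> derived_orth S N -> derived_orth S (sum_mod M N).
Proof.
move=> oM oN A eA f; have [A1 [h [qh nh]]] := oM _ eA (comp_mor f sum_in1).
have eA1 j : S j -> exact_at A1 j by move=> /eA; rewrite (qi_exact _ qh).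
have [A2 [h2 [qh2 nh2]]] := oN _ eA1 (comp_mor h (comp_mor f sum_in2)).
exists A2, (comp_mor h2 h); split; first exact: qi_comp.
apply: nullD (null_compr sum_pr1 (null_compl h2 nh)) (null_compr sum_pr2 nh2) => j x.
by rewrite /= -!morD -sum_split.
Qed.

Lemma derived_orth_summand S : derived_orth S (sum_mod M N) -> derived_orth S M.
Proof.
move=> o A eA f; have [A1 [h [qh nh]]] := o _ eA (comp_mor f sum_pr1).
by exists A1, h; split=> //; apply: null_eq (null_compr sum_in1 nh).
Qed.
End Sum.

Section Pushout.
Variables (M M' A : dgmod R) (q : dgmor M M') (f : dgmor M A) (qq : quasi_iso q).

(** The cone of this morphism is the homotopy pushout of [f] and [q]. *)
Program Definition pair_mor : dgmor M (sum_mod A M') :=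
  @DGMor k R M (sum_mod A M') (fun j x => (f j x, q j x)) _ _ _.
Next Obligation. by move=> j c x y; congr (_, _); rewrite /= mor_lin. Qed.
Next Obligation. by move=> i j h x; congr (_, _); rewrite /= mor_d. Qed.
Next Obligation. by move=> i j l h r x; congr (_, _); rewrite /= mor_act. Qed.

(** Up to coboundaries a cocycle of the pushout has no component in [M], because [q]
    is injective in cohomology, and none in [M'], because [q] is surjective. *)
Lemma pushout_qi : quasi_iso (comp_mor (cone_in pair_mor) (sum_in1 A M')).
Proof.
move=> j; have [i ej] : exists i, j = i + 1 by exists (j - 1); lia.
subst j; split=> [a ca /(coboundaryE erefl)[[m [a' m']]]|[m [a m']] /cone_cocycle[cm]].
  rewrite cone_d => -[/eqP]; rewrite oppr_eq0 => /eqP /(cocycleE erefl) cm.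
  move=> /= <- e2; have [inj _] := qq (i + 1).
  have /(coboundaryE erefl)[m1 <-] : coboundary m.
    apply: inj => //; apply/(coboundaryE erefl); exists (- m').
    by rewrite cxdN; apply/eqP; rewrite eq_sym -addr_eq0 e2.
  by rewrite mor_d -cxdD; apply: coboundary_d.
move=> -[e1 e2].
have [inj _] := qq (i + 1 + 1); have [_ sur] := qq (i + 1).
have /(coboundaryE erefl)[m1 em] : coboundary m.
  apply: inj => //; apply/(coboundaryE erefl); exists (- m').
  by rewrite cxdN; apply/eqP; rewrite eq_sym -addr_eq0 e2.
have [|m2 cm2 /(coboundaryE erefl)[m3 e3]] := sur (m' + q _ m1).
  by apply/(cocycleE erefl); rewrite cxdD -mor_d em -e2; exact: addrC.
exists (a + f _ (m1 - m2)).
  apply/(cocycleE erefl); rewrite cxdD -mor_d cxdD cxdN em.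
  by rewrite ((cocycleE erefl m2).1 cm2) subr0 -e1; exact: addrC.
apply/(coboundaryE erefl); exists (- (m1 - m2), (0, m3)).
rewrite cone_d cxdN opprK cxdD cxdN ((cocycleE erefl m2).1 cm2) em.
congr (_, (_, _)) => /=.
  by rewrite cxd0 addr0 morN opprD addNKr.
rewrite e3 morN morB subr0; move: (q _ m1) (q _ m2) => u v.
by rewrite -[m' + u - v]addrA [LHS]addrCA addNr addr0.
Qed.
End Pushout.

(** The homotopy pushout turns [f] into a morphism out of [M'], up to homotopy. *)
Lemma derived_orth_qi_source S M M' (q : dgmor M M') :
  quasi_iso q -> derived_orth S M' -> derived_orth S M.
Proof.
move=> qq o A eA f; set u := pair_mor q f.
have qj := pushout_qi f qq.
have eA1 j : S j -> exact_at (cone u) j by move=> /eA; rewrite (qi_exact _ qj).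
pose g := opp_mor (comp_mor (cone_in u) (sum_in2 A M')).
have [A2 [h [qh nh]]] := o _ eA1 g.
exists A2, (comp_mor h (comp_mor (cone_in u) (sum_in1 A M'))); split; first exact: qi_comp.
apply: nullD (null_compl h (null_cone_in u)) (null_compr q nh) => j x.
rewrite /= -morD; congr (h j _); congr (_, _); rewrite /= ?subr0 //.
by congr (_, _); rewrite /= ?subr0 ?subrr.
Qed.

Lemma qi_shift_mor n M N (f : dgmor M N) : quasi_iso f -> quasi_iso (shift_mor n f).
Proof.
move=> qf j; have [inj sur] := qf (j + n); split=> [x /shift_cocycle cx /shift_coboundary hx|].
  exact/shift_coboundary/inj.
move=> y /shift_cocycle cy; have [x cx hx] := sur y cy.
by exists x; [exact/shift_cocycle|exact/shift_coboundary].
Qed.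

Lemma unshiftK m n (e : n + m = 0) A j x : reshift A e j (unshift A e j x) = x.
Proof. rewrite /=; exact: (cast_cast _ _ erefl). Qed.

(** A morphism [shift n M -> A] corresponds to [M -> shift (- n) A]. *)
Lemma derived_orth_shift S n M : derived_orth S M -> derived_orth (fun j => S (j + n)) (shift n M).
Proof.
move=> o A eA f.
have e : - n + n = 0 by lia.
have e' : n + - n = 0 by lia.
pose g := comp_mor (shift_mor (- n) f) (reshift M e').
have [|B [h [qh nh]]] := o _ _ g.
  by move=> j Sj; apply/exact_shift; apply: eA; rewrite subrK.
exists (shift n B), (comp_mor (shift_mor n h) (reshift A e)); split.
  by apply: qi_comp; [exact: qi_shift_mor|exact: qi_reshift].
apply: null_eq (null_shift n nh) => j x.
have := unshift_shift_mor e e' f x => /(congr1 (reshift A e j)); rewrite unshiftK => /= ->.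
by [].
Qed.

Program Definition susp_shift M : dgmor (susp M) (shift 1 M) :=
  @DGMor k R (susp M) (shift 1 M) (fun j x => x) _ _ _.
Next Obligation. by []. Qed.
Next Obligation.
by move=> M i j h x /=; rewrite sgnN1 scaleN1r; congr (- _); apply: cxdI.
Qed.
Next Obligation.
by move=> M i j l h r x /=; rewrite mul1r; congr (_ *: _); apply: actI.
Qed.

Lemma qi_susp_shift M : quasi_iso (susp_shift M).
Proof.
move=> j.
have cc (x : M (j + 1)) : cocycle (x : susp M j) <-> cocycle (x : shift 1 M j).
  rewrite !(cocycleE (erefl (j + 1))) -(mor_d (susp_shift M)) /=.
  by [].
have cb (x : M (j + 1)) : coboundary (x : susp M j) <-> coboundary (x : shift 1 M j).
  have h0 : j - 1 + 1 = j by lia.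
  rewrite !(coboundaryE h0); split=> -[y e]; exists y.
    by rewrite -(mor_d (susp_shift M)) e.
  by rewrite -[RHS]e -(mor_d (susp_shift M)).
split=> [x cx hx|y cy]; first by apply/cb.
exists y; first exact/cc.
by rewrite /= subrr; exact: (coboundary_subspace _ _).1.
Qed.

Definition cohom_small (C : complex k) :=
  (forall j, cohom_fg C j) /\ exists a, forall j, j < a -> exact_at C j.

(** Some upper bound on the degrees of generators needed to build [M]. *)
Definition bounded_pd M := exists N : int, derived_orth (fun j => j <= N) M.

Lemma cohom_small_qi M N (f : dgmor M N) : quasi_iso f -> cohom_small M <-> cohom_small N.
Proof.
move=> qf; split=> -[h [a e]]; split.
- by move=> j; rewrite -(qi_cohom_fg _ qf).
- by exists a => j /e; rewrite (qi_exact _ qf).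
- by move=> j; rewrite (qi_cohom_fg _ qf).
- by exists a => j /e; rewrite -(qi_exact _ qf).
Qed.

Lemma bounded_pd_qi M N (f : dgmor M N) : quasi_iso f -> bounded_pd M <-> bounded_pd N.
Proof.
move=> qf; split=> -[n o]; exists n; first exact: derived_orth_qi_target qf o.
exact: derived_orth_qi_source qf o.
Qed.

(** Invariance under quasi-isomorphisms is invariance under their zigzags. *)
Lemma D_iso_ind (Phi : dgmod R -> Prop) M N :
  (forall M N (f : dgmor M N), quasi_iso f -> Phi M <-> Phi N) ->
  D_iso M N -> Phi M <-> Phi N.
Proof.
move=> h; elim=> [{}M {}N [f /h]//|//|? ? _ -> //|? ? ? _ -> _ -> //].
Qed.

Lemma cohom_small_shift n M : cohom_small M -> cohom_small (shift n M).
Proof.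
move=> [h [a e]]; split=> [j|]; first exact/cohom_fg_shift.
by exists (a - n) => j ja; apply/exact_shift/e; lia.
Qed.

Lemma cohom_small_cone M N (f : dgmor M N) : cohom_small M -> cohom_small N -> cohom_small (cone f).
Proof.
move=> [hM [a eM]] [hN [b eN]]; split=> [j|].
  by rewrite cone_cohom_fgE; apply: (cohom_fg_cone _ (erefl (j + 1))).
exists (Order.min a b - 1) => j jab.
by apply: (@les_cone _ _ _ (cx_mor_of f) j _ erefl); [apply: eN|apply: eM]; lia.
Qed.

Lemma zero_exact j : exact_at (zero_mod R) j.
Proof. by apply: exact_at0 => x; exact: thinmx0. Qed.

Lemma cohom_small_sum M N : cohom_small M -> cohom_small N -> cohom_small (sum_mod M N).
Proof.
move=> [hM [a eM]] [hN [b eN]]; split=> [j|]; last first.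
  exists (Order.min a b) => j jab x cx; rewrite (sum_split x).
  apply: (subspaceD (coboundary_subspace _ _)); apply: mor_coboundary.
    by apply: eM; [lia|apply: mor_cocycle].
  by apply: eN; [lia|apply: mor_cocycle].
have [s [cs hs]] := hM j; have [t [ct ht]] := hN j.
have sS := coboundary_subspace (sum_mod M N) j.
exists (map (sum_in1 M N j) s ++ map (sum_in2 M N j) t); split.
  move=> v; rewrite mem_cat => /orP[|] /mapP[u us ->]; apply: mor_cocycle.
    exact: cs.
  exact: ct.
move=> x cx; rewrite (sum_split x); apply: (subspaceD (span_subspace _ sS)).
  apply: span_catl => //; apply: span_map; first exact: mor_lin.
    by move=> u; apply: mor_coboundary.
  by apply: hs; apply: mor_cocycle.
apply: span_catr => //; apply: span_map; first exact: mor_lin.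
  by move=> u; apply: mor_coboundary.
by apply: ht; apply: mor_cocycle.
Qed.

Lemma cohom_small_summand M N : cohom_small (sum_mod M N) -> cohom_small M.
Proof.
move=> [h [a e]]; split=> [j|].
  have [s [cs hs]] := h j; exists (map (sum_pr1 M N j) s); split.
    by move=> v /mapP[u /cs cu ->]; apply: mor_cocycle.
  move=> x cx; rewrite -[x]/(sum_pr1 M N j (sum_in1 M N j x)).
  apply: span_map; first exact: mor_lin.
    by move=> u; apply: mor_coboundary.
  by apply: hs; apply: mor_cocycle.
exists a => j ja x cx; rewrite -[x]/(sum_pr1 M N j (sum_in1 M N j x)).
by apply: mor_coboundary; apply: e => //; apply: mor_cocycle.
Qed.

(** By the Leibniz rule [d 1 = d 1 + d 1]. *)
Lemma cocycle1 : cocycle (dga_one R).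
Proof.
move=> l h.
have h0 : 0 + 0 = 0 :> int by lia.
have h1 : l + 0 = l by lia.
have h2 : 0 + l = l by lia.
have := dga_leibniz h0 h h h h1 h2 (dga_one R) (dga_one R).
rewrite !dga_mul1l !dga_mul1r sgn0 scale1r => /eqP.
by rewrite -subr_eq0 opprD addNKr oppr_eq0 => /eqP.
Qed.

(** A morphism [f] is determined by the cocycle [f 1].  If [f 1 = d y], then
    [x |-> (-1)^i x y], for [x] of degree [i], is a null-homotopy. *)
Lemma left_orth_regular (S : int -> Prop) : S 0 -> left_orth S (regular R).
Proof.
move=> S0 A eA f.
have h0 : 0 - 1 + 1 = 0 :> int by lia.
have /(eA 0 S0) /(coboundaryE h0)[y ey] : cocycle (f 0 (dga_one R)).
  by apply: mor_cocycle; apply: cocycle1.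
have dg (i j : int) : j + 1 = i -> i + (0 - 1) = j by lia.
apply/null_homotopicP; exists (fun i j (h : j + 1 = i) (x : regular R i) =>
  sgn k i *: dgm_act (dg i j h) (x : R i) y); first split.
- by move=> i j h c x z; rewrite dgm_act_linl scalerDr !scalerA mulrC.
- move=> a i j i' j' h h' hi hj r x /=.
  rewrite (dgm_actA hi _ (dg i j h) hj) actZ scalerA sgnM.
  by rewrite hi.
- move=> i j l h h' x /=.
  have h1 : l + (0 - 1) = j by lia.
  have h2 : j + 0 = j by lia.
  rewrite cxdZ (dgm_leibniz _ h' h0 h h1 h2) ey -mor_act /= dga_mul1r.
  by rewrite scalerDr sgnK (sgnS _ h') scaleNr (actI _ h1) addrAC subrr add0r.
Qed.

Lemma cohom_small_iso M N : D_iso M N -> cohom_small M <-> cohom_small N.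
Proof. by apply: (@D_iso_ind cohom_small) => ? ? f; apply: cohom_small_qi. Qed.

Lemma bounded_pd_iso M N : D_iso M N -> bounded_pd M <-> bounded_pd N.
Proof. by apply: (@D_iso_ind bounded_pd) => ? ? f; apply: bounded_pd_qi. Qed.

Lemma bounded_pd_shift n M : bounded_pd M -> bounded_pd (shift n M).
Proof.
move=> [N o]; exists (N - n).
by apply: (derived_orth_mono _ (@derived_orth_shift _ n _ o)) => j /=; lia.
Qed.

Lemma bounded_pd2 M M' : bounded_pd M -> bounded_pd M' -> exists N : int,
  derived_orth (fun j => j <= N) M /\ derived_orth (fun j => j <= N) M'.
Proof.
move=> [a oa] [b ob]; exists (Order.max a b).
by split; [refine (derived_orth_mono _ oa)|refine (derived_orth_mono _ ob)] => j /=; lia.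
Qed.

(** Both properties hold for [R], and are stable under all the rules that build
    compact objects. *)
Lemma Dc_small_bounded M : cohom_small (regular R) -> Dc M -> cohom_small M /\ bounded_pd M.
Proof.
move=> hR; elim=> {M} [|M N i _ [hM oM]|M N C [M' [N' [f [iM iN iC]]]] _ [hM oM] _ [hN oN]
  |M _ [hM oM]|M _ [hM oM]||M N _ [hM oM] _ [hN oN]|M N _ [hM oM]].
- by split=> //; exists 0; apply/left_orth_derived/left_orth_regular.
- by split; [exact/(cohom_small_iso i)|exact/(bounded_pd_iso i)].
- split.
    apply/(cohom_small_iso iC)/cohom_small_cone; first exact/(cohom_small_iso iM).
    exact/(cohom_small_iso iN).
  apply/(bounded_pd_iso iC).
  have [a [o1 o2]] := bounded_pd2 ((bounded_pd_iso iN).1 oN)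
    (bounded_pd_shift 1 ((bounded_pd_iso iM).1 oM)).
  by exists a; apply: derived_orth_cone.
- split; first by apply/(cohom_small_qi (@qi_susp_shift M))/cohom_small_shift.
  by apply/(bounded_pd_qi (@qi_susp_shift M))/bounded_pd_shift.
- have e : 1 + -1 = 0 :> int by [].
  split.
    apply/(cohom_small_qi (qi_reshift M e))/cohom_small_shift.
    exact/(cohom_small_qi (@qi_susp_shift M)).
  apply/(bounded_pd_qi (qi_reshift M e))/bounded_pd_shift.
  exact/(bounded_pd_qi (@qi_susp_shift M)).
- split; last by exists 0; apply/left_orth_derived/left_orth_zero.
  by split=> [j|]; [apply: exact_cohom_fg|exists 0 => j _]; apply: zero_exact.
- split; first exact: cohom_small_sum.
  by have [a [o1 o2]] := bounded_pd2 oM oN; exists a; apply: derived_orth_sum.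
- split; first exact: cohom_small_summand hM.
  by case: oM => a /derived_orth_summand o; exists a.
Qed.
End DerivedOrth.

(** * Attaching free generators *)

Section Attach.
Variables (k : fieldType) (R : scDGA k).
Implicit Types F G M P A : dgmod R.

(** Free of rank one, on a generator of degree [d]. *)
Definition free_mod (d : int) : dgmod R := shift (- d) (regular R).

Lemma left_orth_free (S : int -> Prop) d : S d -> left_orth S (free_mod d).
Proof.
move=> Sd; have o : left_orth (fun j => j = 0) (regular R) by apply: left_orth_regular.
apply: (left_orth_mono _ (left_orth_shift (n := - d) o)) => j /eqP.
by rewrite subr_eq0 => /eqP->.
Qed.

Lemma left_orth_free_shift1 (S : int -> Prop) d : S d -> left_orth S (shift 1 (free_mod (d + 1))).
Proof.
move=> Sd; have o : left_orth (fun j => j = d + 1) (free_mod (d + 1)) by apply: left_orth_free.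
by apply: (left_orth_mono _ (left_orth_shift (n := 1) o)) => j /addIr->.
Qed.

Section FreeMap.
Variables (P : dgmod R) (d : int) (z : P d) (cz : cocycle z).

(** The morphism sending the generator to [z]; the sign makes it linear for the
    twisted action on a shift. *)
Program Definition free_map : dgmor (free_mod d) P :=
  @DGMor k R (free_mod d) P
    (fun j x => sgn k (d * j) *: dgm_act (subrK d j) (x : R (j - d)) z) _ _ _.
Next Obligation.
by move=> j c x y; rewrite dgm_act_linl scalerDr !scalerA mulrC.
Qed.
Next Obligation.
move=> i j h x /=; subst j.
rewrite actZl scalerA cxdZ (dgm_leibniz (subrK d i) (shift_deg (- d) erefl) (erefl (d + 1)) erefl
  (subrK d (i + 1)) (degAS (subrK d i))).
rewrite cz act0 scaler0 addr0 sgnM; congr (sgn k _ *: _).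
by rewrite mulrDr mulr1 addrK.
Qed.
Next Obligation.
move=> i j l h r x /=.
rewrite actZl scalerA actZ (dgm_actA _ _ (subrK d j) h) sgnM.
congr (sgn k _ *: _); subst l.
by rewrite mulrDr mulNr addrAC subrr add0r.
Qed.

Variables (e : int) (h0 : e + 1 = d) (y : P e) (hy : cx_d h0 y = z).

Lemma free_htpy_deg (i j : int) : j + 1 = i -> i - d + e = j.
Proof. by lia. Qed.

(** Explicit, because its value on the generator is used in [attach_kill]. *)
Definition free_htpy : homotopy (free_mod d) P :=
  fun i j h x => sgn k (d * i + (i - d)) *: dgm_act (free_htpy_deg h) (x : R (i - d)) y.

Lemma free_htpyP : is_homotopy free_htpy /\
  forall i j l (h : i + 1 = j) (h' : j + 1 = l) x,
     free_map j x = cx_d h (free_htpy h x) + free_htpy h' (cx_d h' x).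
Proof.
split; first split.
- by move=> i j h c x x'; rewrite /free_htpy dgm_act_linl scalerDr !scalerA mulrC.
- move=> a i j i' j' h h' hi hj r x; rewrite /free_htpy /=.
  rewrite actZl scalerA actZ (dgm_actA _ _ (free_htpy_deg h) hj) scalerA !sgnM.
  by congr (sgn k _ *: _); rewrite -{h' x}hi mulrDr mulNr; lia.
- move=> i j l h h' x; rewrite /free_htpy /=.
  rewrite cxdZ (dgm_leibniz (free_htpy_deg h) (shift_deg (- d) h') h0 h
    (free_htpy_deg h') (subrK d j)) hy.
  rewrite actZl scalerA scalerDr scalerA !sgnM.
  rewrite -[(d * j + (j - d) + (j - d))]addrA -!(sgnM _ (d * j)) sgn_double mulr1.
  have -> : d * l + (l - d) - d = d * j + (j - d) + 1.
    by rewrite -{h}h' mulrDr mulr1; lia.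
  rewrite -(sgnM _ (_ + _) 1) -(sgnM _ (d * j) (j - d)) sgnN1 mulrN1 scaleNr.
  by rewrite [RHS]addrAC subrr add0r.
Qed.
End FreeMap.

(** The generator of a free module: the unit of [R] seen in a degree equal to [0],
    such as [d - d]. *)
Definition unit_at (i : int) (e : 0 = i) : R i := cast e (dga_one R).

Lemma act_unit P i (e : 0 = i) j l (h : i + j = l) (h' : j = l) (x : P j) :
  dgm_act h (unit_at e) x = cast h' x.
Proof. by subst i; move: h; case: _ / h' => h; exact: dgm_act1. Qed.

Lemma unit_atP i (e : 0 = i) (x : R i) : exists c, x = c *: unit_at e.
Proof. by subst i; exists (aug x); exact: augK. Qed.

Lemma attach_deg (p : int) : 0 = p + 1 + 1 - (p + 1 + 1). Proof. by lia. Qed.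

Lemma unit_cocycle d i (e : 0 = i - d) : cocycle (unit_at e : free_mod d i).
Proof.
apply/(cocycleE erefl).
rewrite /= (cast_dl _ _ (etrans (congr1 (+%R^~ 1) e) (shift_deg (- d) erefl))).
by rewrite cocycle1 scaler0.
Qed.

(** The two degree hypotheses on [R]; this is where [R^1 = 0] enters. *)
Lemma R_small i (x : R i) : i < 0 \/ i = 1 -> x = 0.
Proof. by case=> [/dga_neg//|e]; subst i; exact: dga_R1. Qed.

Section ConeMor.
Variables (F F' M : dgmod R) (phi : dgmor F M) (psi : dgmor F' M) (a : dgmor F F').
Hypothesis e : forall j x, psi j (a j x) = phi j x.

Program Definition cone_mor : dgmor (cone phi) (cone psi) :=
  @DGMor k R (cone phi) (cone psi) (fun j z => (a _ z.1, z.2)) _ _ _.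
Next Obligation. by move=> j c x y; congr (_, _); rewrite /= mor_lin. Qed.
Next Obligation.
by move=> i j h [y m]; subst j; rewrite [RHS]cone_d cone_d /= e morN mor_d.
Qed.
Next Obligation. by move=> i j l h r x; congr (_, _); rewrite /= morZ mor_act. Qed.
End ConeMor.

(** The pair [(f, m)] is a cocycle of degree [p + 1] of the cone of [phi].  The module
    [cone g] is [F] with one more generator, of degree [p + 1], whose differential is
    [f] up to sign, and [m] provides the value of [phi] on it. *)
Section AttachKill.
Variables (F M : dgmod R) (phi : dgmor F M) (p : int) (f : F (p + 1 + 1)) (m : M (p + 1)).
Hypothesis cf : cocycle f.
Hypothesis cm : phi _ f + cx_d erefl m = 0.

Let g := free_map cf.

Lemma attach_kill_bound : cx_d erefl (- m) = phi _ f.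
Proof. by rewrite cxdN; apply/eqP; rewrite eq_sym -addr_eq0 cm. Qed.

Let s : homotopy (free_mod (p + 1 + 1)) M := free_htpy (erefl (p + 1 + 1)) (- m).
Let sg := sgn k ((p + 1 + 1) * (p + 1 + 1)).
Let u : R (p + 1 + 1 - (p + 1 + 1)) := unit_at (attach_deg p).

Lemma attach_kill_map1 : g _ u = sg *: f.
Proof. by rewrite /= (act_unit _ _ erefl). Qed.

Lemma attach_kill_htpy1 : s erefl u = - (sg *: m).
Proof.
rewrite /s /free_htpy (act_unit _ _ erefl) /= subrr addr0 scalerN //.
Qed.

Lemma attach_kill_extend : exists psi : dgmor (cone g) M, forall j x y,
  psi j (x, y) = phi j y + s (erefl (j + 1)) x.
Proof.
have cpf := mor_cocycle phi cf.
have [hs es] := free_htpyP cpf attach_kill_bound.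
apply: (cone_ext hs) => i j l h h' x; rewrite -es /=.
by rewrite morZ mor_act.
Qed.

(** In degrees [<= p + 1], the cones of [phi] and [psi] can differ only by the
    multiples of the new generator: the next elements of the new free summand
    would have coefficients in [R^1], and there are none below.  The generator
    itself sits in degree [p] of the cone of [psi], and no nonzero multiple of it
    can be completed to a cocycle, unless [(f, m)] is a coboundary. *)
Lemma attach_kill : exists (psi : dgmor (cone g) M) (iota : dgmor (cone phi) (cone psi)),
  [/\ forall j y, psi j (0, y) = phi j y,
      coboundary (iota (p + 1) (f, m)),
      forall j, j <= p + 1 -> j != p -> forall w, cocycle w ->
        exists2 z, cocycle z & w = iota j z
    & ~ coboundary ((f, m) : cone phi (p + 1)) ->
      exact_at (cone phi) p -> exact_at (cone psi) p].
Proof.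
have [psi epsi] := attach_kill_extend.
have lins i j (h : j + 1 = i) : linear (s h).
  exact: (free_htpyP (mor_cocycle phi cf) attach_kill_bound).1.1.
have e0 j y : psi j (0, y) = phi j y by rewrite epsi (lin0 (lins _ _ _)) addr0.
pose iota := cone_mor (phi := phi) (psi := psi) (a := cone_in g) e0.
have cio j (w : cone psi j) : cocycle w -> w.1.1 = 0 ->
    exists2 z, cocycle z & w = iota j z.
  case: w => -[x y] m' cw /= x0; subst x; exists (y, m') => //.
  move=> l h; have := cw l h; rewrite -[((0, y), m')]/(iota j (y, m')) -mor_d.
  by case: (cx_d _ _) => b b' /= [-> ->].
exists psi, iota; split=> //.
- have : coboundary (cx_d (erefl (p + 1)) (((u, 0), 0) : cone psi p)).
    exact: coboundary_d.
  rewrite cone_d cxd0 addr0 cone_d cxd0 addr0 epsi mor0 add0r.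
  rewrite attach_kill_map1 attach_kill_htpy1 (unit_cocycle (i := p + 1 + 1)).
  move=> /(subspaceZ (- sg) (coboundary_subspace _ _)).
  suff -> : iota (p + 1) (f, m) = - sg *: (- (- 0, sg *: f), - (sg *: m)) by [].
  congr ((_, _), _) => /=.
  + by rewrite !oppr0 scaler0.
  + by rewrite scaleNr scalerN opprK sgnK.
  + by rewrite scaleNr scalerN opprK sgnK.
- move=> j jp jn w cw; apply: cio => //; apply: R_small; lia.
move=> nc eC w cw; suff : w.1.1 = 0.
  by case/(cio _ _ cw) => z /eC bz ->; apply: mor_coboundary.
case: w cw => -[x y] m' /= /cone_cocycle[/cone_cocycle[_ e1]].
rewrite epsi; move: e1; have [c ->] := unit_atP (attach_deg p) x => e1 e2.
have [->|c0] := eqVneq c 0; first by rewrite scale0r.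
case: nc; have gcu : g _ (c *: u) = c *: (sg *: f) by rewrite morZ attach_kill_map1.
have scu : s erefl (c *: u) = - (c *: (sg *: m)).
  by rewrite (linZ (lins _ _ _)) attach_kill_htpy1 scalerN.
apply/(coboundaryE erefl); exists ((c^-1 * sg) *: (y, m')).
rewrite cxdZ cone_d.
have -> : cx_d erefl y = - (c *: (sg *: f)).
  by apply/eqP; rewrite -gcu -addr_eq0 [_ + g _ _]addrC; apply/eqP; exact: e1.
have -> : phi (p + 1) y + cx_d erefl m' = c *: (sg *: m).
  apply/eqP; rewrite -subr_eq0 -scu addrAC; apply/eqP; exact: e2.
have cc (V : lmodType k) (v : V) : (c^-1 * sg) *: (c *: (sg *: v)) = v.
  have -> : c *: (sg *: v) = sg *: (c *: v) by rewrite !scalerA mulrC.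
  by rewrite -scalerA sgnK scalerA mulVf // scale1r.
by rewrite opprK; congr (_, _); exact: cc.
Qed.

End AttachKill.

(** [attach ds i]: [G] is obtained from [F] by attaching successively free generators
    of degrees [ds], and [i] is the inclusion.  The inclusion is specified only
    pointwise, since equality of morphisms involves equality of proofs. *)
Inductive attach : forall F, seq int -> forall G, dgmor F G -> Prop :=
| att_nil F (i : dgmor F F) : (forall j x, i j x = x) -> attach [::] i
| att_cons F d (f : dgmor (free_mod (d + 1)) F) ds G (i : dgmor (cone f) G)
    (i' : dgmor F G) :
    attach ds i -> (forall j x, i' j x = i j (cone_in f j x)) -> attach (d :: ds) i'.

Lemma attach_eq F ds G (i i' : dgmor F G) :
  attach ds i -> (forall j x, i' j x = i j x) -> attach ds i'.
Proof.
move=> a; case: a i' => {F ds G i} [F i e|F d f ds G i i1 a e1] i' e'.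
  by apply: att_nil => j x; rewrite e'.
by apply: att_cons a _ => j x; rewrite e'.
Qed.

Lemma attach_cat F ds G (i : dgmor F G) ds' H (i' : dgmor G H) :
  attach ds i -> attach ds' i' -> attach (ds ++ ds') (comp_mor i' i).
Proof.
move=> a; elim: a H i' => {F ds G i} [F i e|F d f ds G i i1 a IH e1] H i' a' /=.
  by apply: attach_eq a' _ => j x; rewrite /= e.
by apply: (att_cons (IH _ _ a')) => j x; rewrite /= e1.
Qed.

Lemma attach_left_orth S F ds G (i : dgmor F G) : attach ds i -> left_orth S F ->
  {in ds, forall d, S d} -> left_orth S G.
Proof.
elim=> {F ds G i} [//|F d f ds G i i1 a IH _] oF hS; apply: IH.
  apply: left_orth_cone => //; apply: left_orth_free_shift1; apply: hS; exact: mem_head.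
by move=> x xs; apply: hS; rewrite inE xs orbT.
Qed.

Lemma free_mod_cohom_small d : cohom_small R -> cohom_small (free_mod d).
Proof. exact: (@cohom_small_shift _ _ _ (regular R)). Qed.

Lemma attach_cohom_small F ds G (i : dgmor F G) : cohom_small R -> attach ds i ->
  cohom_small F -> cohom_small G.
Proof.
move=> hR; elim=> {F ds G i} [//|F d f ds G i i1 a IH _] hF; apply: IH.
by apply: cohom_small_cone => //; apply: free_mod_cohom_small.
Qed.

(** Obstruction theory: the obstruction to extending [f] to a generator of degree
    [d] is a class of degree [d + 1] of [A]. *)
Lemma attach_extend (A : dgmod R) F ds G (i : dgmor F G) (f : dgmor F A) :
  attach ds i -> {in ds, forall d, exact_at A (d + 1)} ->
  exists f' : dgmor G A, forall j x, f' j (i j x) = f j x.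
Proof.
move=> a; elim: a f => {F ds G i} [F i e|F d g ds G i i1 a IH e1] f hS.
  by exists f => j x; rewrite e.
have [|f1 h1] := @cone_ext_null _ _ _ _ g A f.
  apply: (@left_orth_free (fun j => j = d + 1)) => // j ->; apply: hS; exact: mem_head.
have [|f' h'] := IH f1; first by move=> x xs; apply: hS; rewrite inE xs orbT.
by exists f' => j x; rewrite e1 h' /= h1.
Qed.

(** Induction on the number of classes that span the cohomology of the cone in
    degree [p + 1].  A class that is already zero is dropped, which ensures that
    [attach_kill] does not destroy exactness in degree [p]. *)
Lemma resolve_step F M (phi : dgmor F M) p :
  (forall j, j <= p -> exact_at (cone phi) j) -> cohom_fg (cone phi) (p + 1) ->
  exists ds G (i : dgmor F G) (psi : dgmor G M),
    [/\ attach ds i, {in ds, forall d, d = p + 1},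
       forall j x, psi j (i j x) = phi j x
     & forall j, j <= p + 1 -> exact_at (cone psi) j].
Proof.
move=> + [s]; have [n] := ubnP (size s).
elim: n F phi s => // n IH F phi [|c s] hn eC [cs hs].
  exists [::], F, (id_mor F), phi; split=> //; first exact: att_nil.
  move=> j; rewrite le_eqVlt => /orP[/eqP->|jp]; first exact: hs.
  by apply: eC; lia.
have [bc|nbc] := pselect (coboundary c).
  by apply: (IH F phi s) => //; apply: spans_cohom_drop bc (conj cs hs).
have cc : cocycle c by apply: cs; apply: mem_head.
move ec : c cc nbc => c' cc nbc; case: c' cc nbc ec => f m cfm nbc ec.
have [cf cm] := (cone_cocycle phi f m).1 cfm.
have [psi [iota [h1 h2 h3 h4]]] := attach_kill cf cm.
have eC' j : j <= p -> exact_at (cone psi) j.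
  rewrite le_eqVlt => /orP[/eqP->|jp]; first by apply: h4 => //; apply: eC.
  move=> w /h3[||z /eC bz ->]; [by lia|by lia|apply: mor_coboundary; apply: bz; lia].
have hsz : (size (map (iota (p + 1)%R) s) < n)%N by rewrite size_map.
have hsp : spans_cohom (map (iota (p + 1)) s).
  split=> [v /mapP[z zs ->]|w /h3[//||z cz ->]].
  - by apply: mor_cocycle; apply: cs; rewrite inE zs orbT.
  - by lia.
  have [a ha] := hs z cz; rewrite ec in ha.
  rewrite -[z](subrK (a *: (f, m))) morD morZ.
  have sC' := coboundary_subspace (cone psi) (p + 1).
  apply: (subspaceD (span_subspace _ sC')).
    apply: span_map ha; first exact: mor_lin.
    by move=> x; apply: mor_coboundary.
  by apply: (span_base _ sC'); apply: subspaceZ.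
have [ds [G [i [psi' [a1 a2 a3 a4]]]]] := IH _ psi _ hsz eC' hsp.
exists (p + 1 :: ds), G, (comp_mor i (cone_in (free_map cf))), psi'; split=> //.
- exact: att_cons a1 _.
- by move=> d; rewrite inE => /orP[/eqP//|/a2].
- by move=> j x; rewrite /= a3 h1.
Qed.

Definition nondecreasing_degrees := pairwise (fun a b : int => a <= b).

Lemma resolve F M (phi : dgmor F M) n (m : nat) :
  (forall j, j <= n -> exact_at (cone phi) j) -> cohom_small R -> cohom_small F -> cohom_small M ->
  exists ds G (i : dgmor F G) (psi : dgmor G M),
    [/\ attach ds i, nondecreasing_degrees ds /\ {in ds, forall d, n < d <= n + m%:Z},
       forall j x, psi j (i j x) = phi j x
     & forall j, j <= n + m%:Z -> exact_at (cone psi) j].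
Proof.
move=> eC hR hF hM; elim: m => [|m [ds [G [i [psi [a1 [a2 a2'] a3 a4]]]]]].
  exists [::], F, (id_mor F), phi; split=> //; first exact: att_nil.
  by move=> j; rewrite addr0; apply: eC.
have hG := attach_cohom_small hR a1 hF.
have hC : cohom_fg (cone psi) (n + m%:Z + 1) by have [] := cohom_small_cone psi hG hM.
have [ds' [G' [i' [psi' [b1 b2 b3 b4]]]]] := resolve_step a4 hC.
have enm : n + m.+1%:Z = n + m%:Z + 1 by lia.
exists (ds ++ ds'), G', (comp_mor i' i), psi'; split.
- exact: attach_cat.
- split.
    rewrite /nondecreasing_degrees pairwise_cat -!/nondecreasing_degrees a2 /=; apply/andP; split.
      by apply/allrelP => x y /a2' hx /b2 ->; lia.
    apply/(pairwiseP 0) => x y xs ys _.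
    by rewrite (b2 _ (mem_nth _ xs)) (b2 _ (mem_nth _ ys)).
  by move=> d; rewrite mem_cat => /orP[/a2'|/b2 ->]; lia.
- by move=> j x; rewrite /= b3 a3.
- by move=> j; rewrite enm; apply: b4.
Qed.

(** The starting point [F] is left open: it is [0] for a general module, and [R]
    for the residue field. *)
Lemma resolve_compact F M (phi : dgmor F M) n : cohom_small R ->
  (forall j, j <= n -> exact_at (cone phi) j) -> cohom_small F -> left_orth (fun j => j <= n) F ->
  Dc M ->
  exists ds G (i : dgmor F G) (psi : dgmor G M),
    [/\ attach ds i, nondecreasing_degrees ds, {in ds, forall d, n < d},
       forall j x, psi j (i j x) = phi j x & quasi_iso psi].
Proof.
move=> hR eC hF oF DM; have [hM [N oM]] := Dc_small_bounded hR DM.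
(* Large enough for [N <= n + m]. *)
pose m := `|N - n|%N.
have [ds [G [i [psi [a1 [a2 a2'] a3 a4]]]]] := resolve m eC hR hF hM.
exists ds, G, i, psi; split=> //; first by move=> d /a2' /andP[].
have Nm : N <= n + m%:Z by rewrite /m; lia.
apply/qi_cone; move: (n + m%:Z) a2' a4 Nm (lerDl n m%:Z : (n <= n + m%:Z) = (0 <= m%:Z)).
move=> b a2' a4 Nb; rewrite le0z_nat => nb.
have oG : left_orth (fun j => j <= b) G.
  apply: (attach_left_orth a1); first by apply: (left_orth_mono _ oF) => j; lia.
  by move=> d /a2' /andP[].
have oG1 : left_orth (fun j => j <= b) (shift 1 G).
  by apply: (left_orth_mono _ (left_orth_shift (n := 1) oG)) => j; lia.
have oM' : derived_orth (fun j => j <= b) M by apply: (derived_orth_mono _ oM) => j; lia.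
(* A quasi-isomorphism [h] out of the cone kills [M]; it then factors through the
   suspension of [G], which has no morphism to modules exact in degrees [<= b]. *)
have [C' [h [qh nh]]] := oM' _ a4 (cone_in psi).
have [v hv] := cone_fact (w := h) nh.
have eC' j : j <= b -> exact_at C' j by move=> /a4; rewrite (qi_exact _ qh).
move=> j; apply: (qi_null_exact qh); apply: homotopic_null hv _.
by apply: null_compr; apply: oG1.
Qed.
End Attach.

(** * Tensor products *)

Definition mklin (k : fieldType) (U V : lmodType k) (f : U -> V) (h : linear f) :
  {linear U -> V} := HB.pack_for {linear U -> V} f (GRing.isLinear.Build k U V *:%R f h).

Lemma mklinE (k : fieldType) (U V : lmodType k) (f : U -> V) (h : linear f) x :
  mklin h x = f x.
Proof. by []. Qed.

Section Tensor.
Variables (k : fieldType) (R : dgAlg k) (X : rdgmod R).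
Implicit Types (P Q : dgmod R) (T : complex k).

Definition pairing P T := forall l i j : int, i + j = l -> X i -> P j -> T l.

Definition tensor_by P T (tau : pairing P T) :=
  [/\ forall l, balanced (tau l),
      forall i j l i' j' l' (h : i + j = l) (hi : i + 1 = i')
          (hj : j + 1 = j') (hl : l + 1 = l') (h1 : i' + j = l') (h2 : i + j' = l') x p,
        cx_d hl (tau l i j h x p) =
          tau l' i' j h1 (cx_d hi x) p + sgn k i *: tau l' i j' h2 x (cx_d hj p)
    & forall l (W : lmodType k) phi, @balanced k R X P l W phi ->
        exists2 g : {linear T l -> W},
          forall i j h x p, g (tau l i j h x p) = phi i j h x p
        & forall g' : {linear T l -> W},
            (forall i j h x p, g' (tau l i j h x p) = phi i j h x p) -> g' =1 g].

Lemma is_tensorE P T : is_tensor X P T <-> exists tau : pairing P T, tensor_by tau.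
Proof. by []. Qed.

Lemma pairingI P T (tau : pairing P T) l i j (h h' : i + j = l) x p :
  tau l i j h x p = tau l i j h' x p.
Proof. by rewrite (eq_irrelevance h h'). Qed.

(** The uniqueness part of the universal property, for maps whose linearity is a
    separate proof. *)
Lemma tensor_ext P T (tau : pairing P T) l (W : lmodType k) (g g' : T l -> W) :
  tensor_by tau -> linear g -> linear g' ->
  (forall i j h x p, g (tau l i j h x p) = g' (tau l i j h x p)) -> g =1 g'.
Proof.
move=> [tb _ tu] lg lg' e; have [b1 b2 b3] := tb l.
have [|G eG uG] := tu l W (fun i j h x p => g (tau l i j h x p)).
  split=> [i j h p c x y|i j h x c p q|i a j ia aj hx hp h h' x r p].
  - by rewrite b1 lg.
  - by rewrite b2 lg.
  - by rewrite (b3 _ _ _ _ _ hx hp h h').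
move=> t; rewrite -(mklinE lg) -(mklinE lg') (uG (mklin lg)) //.
by rewrite (uG (mklin lg')) // => *; rewrite mklinE e.
Qed.

Lemma tensor_rec P T (tau : pairing P T) l (W : lmodType k) phi :
  tensor_by tau -> @balanced k R X P l W phi ->
  exists2 g : T l -> W, linear g & forall i j h x p, g (tau l i j h x p) = phi i j h x p.
Proof.
by move=> [_ _ tu] /tu[g eg _]; exists g => //; exact: linearP.
Qed.

(** A criterion with the smallest instances of the Leibniz rule, and with uniqueness
    stated as the vanishing of linear maps that vanish on pure tensors. *)
Lemma tensor_mk P T (tau : pairing P T) :
  (forall l, balanced (tau l)) ->
  (forall i j l (h : i + j = l) x p,
     cx_d erefl (tau l i j h x p) =
       tau (l + 1) (i + 1) j (etrans (addrAC i 1 j) (congr1 (+%R^~ 1) h)) (cx_d erefl x) p +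
       sgn k i *: tau (l + 1) i (j + 1) (degAS h) x (cx_d erefl p)) ->
  (forall l (W : lmodType k) phi, @balanced k R X P l W phi ->
     exists2 g : T l -> W, linear g & forall i j h x p, g (tau l i j h x p) = phi i j h x p) ->
  (forall l (W : lmodType k) (g : T l -> W), linear g ->
     (forall i j h x p, g (tau l i j h x p) = 0) -> forall t, g t = 0) ->
  tensor_by tau.
Proof.
move=> tb td tr tz; split=> // [i j l i' j' l' h hi hj hl h1 h2 x p|l W phi /tr[g lg eg]].
  subst i' j' l'; rewrite td; congr (_ + _ *: _); exact: pairingI.
exists (mklin lg); first by move=> *; rewrite mklinE eg.
move=> g' eg' t; apply/eqP; rewrite -subr_eq0; apply/eqP.
apply: (tz l W (fun t => g' t - mklin lg t)).
  by move=> c x y; rewrite linearP !mklinE lg scalerBr opprD addrACA.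
by move=> i j h x p; rewrite eg' mklinE eg subrr.
Qed.

Lemma tensor_regular : is_tensor X (regular R) X.
Proof.
pose tau : pairing (regular R) X := fun l i j h x r => rdgm_act h x (r : R j).
apply/is_tensorE; exists tau.
have b l : balanced (tau l).
  split=> [i j h p|i j h x|i a j ia aj hx hp h h' x r p].
  - exact: rdgm_act_linl.
  - exact: rdgm_act_linr.
  - exact: rdgm_actA.
apply: tensor_mk => // [i j l h x p|l W phi [b1 b2 b3]|l W g lg e t].
- exact: rdgm_leibniz.
- exists (fun x => phi l 0 (addr0 l) x (dga_one R)); first exact: b1.
  move=> i j h x r; rewrite (b3 _ _ _ _ _ h (addr0 j) _ h) /=.
  by rewrite dga_mul1r.
- by rewrite -(rdgm_act1 (addr0 l) t) e.
Qed.

Lemma tensor_zero : is_tensor X (zero_mod R) (zero_cx k).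
Proof.
pose tau : pairing (zero_mod R) (zero_cx k) := fun l i j h x r => 0.
apply/is_tensorE; exists tau.
apply: tensor_mk => [l|i j l h x p|l W phi [b1 b2 b3]|l W g lg e t].
- split=> [i j h p c x y|i j h x c p q|//] /=; by rewrite scaler0 addr0.
- by rewrite scaler0 addr0.
- exists (fun _ => 0); first by move=> c x y; rewrite scaler0 addr0.
  by move=> i j h x p; rewrite (thinmx0 p) (lin0 (b2 _ _ _ _)).
- by rewrite (thinmx0 t) (lin0 lg).
Qed.

Lemma tensor_map P Q T U (tau : pairing P T) (ups : pairing Q U) (f : dgmor P Q) :
  tensor_by tau -> tensor_by ups -> exists F : cx_mor T U,
  forall l i j h x p, F l (tau l i j h x p) = ups l i j h x (f j p).
Proof.
move=> tT tU.
have H l : exists g : T l -> U l, linear g /\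
    forall i j h x p, g (tau l i j h x p) = ups l i j h x (f j p).
  have [|g lg eg] := @tensor_rec _ _ tau l (U l)
    (fun i j h x p => ups l i j h x (f j p)) tT; last by exists g.
  case: tU => tb _ _; have [b1 b2 b3] := tb l.
  split=> [i j h p|i j h x c p q|i a j ia aj hx hp h h' x r p].
  - exact: b1.
  - by rewrite mor_lin b2.
  - by rewrite (b3 _ _ _ _ _ hx hp h h') mor_act.
have [F hF] : exists F : forall l, T l -> U l, forall l, linear (F l) /\
    forall i j h x p, F l (tau l i j h x p) = ups l i j h x (f j p).
  by exists (fun l => sval (cid (H l))) => l; exact: svalP (cid (H l)).
have dF i j (h : i + 1 = j) x : F j (cx_d h x) = cx_d h (F i x).
  subst j; move: x; apply: (tensor_ext tT).
  - by move=> c x y; rewrite cx_d_lin (hF _).1.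
  - by move=> c x y; rewrite (hF _).1 cx_d_lin.
  move=> a b h x p; case: tT => _ dT _; case: tU => _ dU _.
  have h1 : a + 1 + b = i + 1 by lia.
  rewrite (dT _ _ _ _ _ _ h erefl erefl erefl h1 (degAS h)) (hF _).2.
  rewrite (dU _ _ _ _ _ _ h erefl erefl erefl h1 (degAS h)).
  by rewrite (linD (hF _).1) (linZ (hF _).1) !(hF _).2 mor_d.
by exists (CxMor (fun j => (hF j).1) dF) => l i j h x p /=; rewrite (hF l).2.
Qed.

(** A contraction [s] of [P] induces the contraction
    [x (x) p |-> (-1)^i x (x) s p], for [x] of degree [i]. *)
Lemma tensor_contractible P T (tau : pairing P T) :
  tensor_by tau -> null_homotopic (id_mor P) -> forall l, exact_at T l.
Proof.
move=> tT /null_homotopicP[s [s1 s2] es].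
have H l' l (e : l' + 1 = l) : exists S : T l -> T l', linear S /\
   forall i j h x p j1 (e1 : j1 + 1 = j) (h1 : i + j1 = l'),
     S (tau l i j h x p) = sgn k i *: tau l' i j1 h1 x (s j j1 e1 p).
  have e0 (j : int) : j - 1 + 1 = j by lia.
  have e2 (i j : int) : i + j = l -> i + (j - 1) = l' by lia.
  case: (tT) => tb _ _; have [b1 b2 b3] := tb l'.
  have [|S lS eS] := @tensor_rec _ _ tau l (T l') (fun i j h x p =>
     sgn k i *: tau l' i (j - 1) (e2 i j h) x (s j (j - 1) (e0 j) p)) tT.
    split=> [i j h p c x y|i j h x c p q|i a j ia aj hx hp h h' x r p].
    - by rewrite b1 scalerDr !scalerA mulrC.
    - by rewrite s1 b2 scalerDr !scalerA mulrC.
    - have hj : a + (j - 1) = aj - 1 by lia.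
      rewrite (s2 _ _ _ _ _ (e0 j) _ _ hj) (b3 _ _ _ _ _ hx hj _ (e2 i aj h')).
      by rewrite (linZ (b2 _ _ _ _)) scalerA (sgnD k hx).
  exists S; split=> // i j h x p j1 e1 h1; rewrite eS.
  have ej : j1 = j - 1 by lia.
  by subst j1; rewrite (homotopyI s e1 (e0 j)) (pairingI _ h1 (e2 i j h)).
move=> l t ct.
have e0 : l - 1 + 1 = l by lia.
have [S [lS eS]] := H _ _ e0; have [S' [lS' eS']] := H _ _ (erefl (l + 1)).
have /(_ t) : (fun t => cx_d e0 (S t) + S' (cx_d erefl t)) =1 id.
  apply: (tensor_ext tT) => [c x y|//|i j h x p].
    by rewrite lS !cx_d_lin lS' scalerDr addrACA.
  case: (tT) => tb dT _; have [b1 b2 b3] := tb l.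
  have e1 : j - 1 + 1 = j by lia.
  have h1 : i + (j - 1) = l - 1 by lia.
  have h2 : i + 1 + (j - 1) = l by lia.
  have h3 : i + 1 + j = l + 1 by lia.
  rewrite (eS _ _ h _ _ _ e1 h1) cxdZ (dT _ _ _ _ _ _ h1 erefl e1 e0 h2 h).
  rewrite (dT _ _ _ _ _ _ h erefl erefl erefl h3 (degAS h)).
  rewrite (linD lS') (linZ lS') (eS' _ _ h3 _ _ _ e1 h2) (eS' _ _ (degAS h) _ _ _ erefl h).
  rewrite scalerDr !sgnK (sgnS k (erefl (i + 1))) scaleNr.
  have := congr1 (tau l i j h x) (es _ _ _ e1 erefl p).
  rewrite /= (linD (b2 _ _ _ _)) => ->.
  by rewrite addrACA subrr add0r.
by rewrite ((cocycleE erefl t).1 ct) (lin0 lS') addr0 => <-; apply: coboundary_d.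
Qed.

Section ComplexShift.
Variables (n : int) (C : complex k).
Program Definition cx_shift : complex k :=
  @Complex k (fun j => C (j + n)) (fun i j h x => cx_d (shift_deg n h) x) _ _.
Next Obligation. by move=> i j h c x y /=; rewrite cx_d_lin. Qed.
Next Obligation. by move=> i j l h h' x /=; rewrite cx_dd. Qed.

Lemma exact_cx_shift j : exact_at cx_shift j <-> exact_at C (j + n).
Proof.
have h0 : j - 1 + 1 = j by lia.
have cc (x : C (j + n)) : cocycle (x : cx_shift j) <-> cocycle x.
  by rewrite (cocycleE (erefl (j + 1)) (x : cx_shift j)) (cocycleE (shift_deg n (erefl (j + 1)))).
have cb (x : C (j + n)) : coboundary (x : cx_shift j) <-> coboundary x.
  by rewrite (coboundaryE h0 (x : cx_shift j)) (coboundaryE (shift_deg n h0)).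
by split=> e x /cc /e /cb.
Qed.
End ComplexShift.

Lemma shift_deg' n (i j l : int) : i + j = l + n -> i + (j - n) = l.
Proof. by lia. Qed.

(** The sign [(-1)^(n j)] absorbs the signs of the shifted module, so that the
    complex [T] is shifted without sign. *)
Lemma tensor_shift n P T : is_tensor X P T -> is_tensor X (shift n P) (cx_shift n T).
Proof.
move=> /is_tensorE[tau tT]; apply/is_tensorE.
pose ta : pairing (shift n P) (cx_shift n T) := fun l i j h x p =>
  sgn k (n * j) *: tau (l + n) i (j + n) (shift_act_deg n h) x p.
exists ta; case: (tT) => tb dT _.
apply: tensor_mk => [l|i j l h x p|l W phi bphi|l W g lg e].
- have [b1 b2 b3] := tb (l + n).
  split=> [i j h p c x y|i j h x c p q|i a j ia aj hx hp h h' x r p]; rewrite /ta.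
  + by rewrite b1 scalerDr !scalerA mulrC.
  + by rewrite b2 scalerDr !scalerA mulrC.
  + rewrite (b3 _ _ _ _ _ hx (shift_act_deg n hp) _ (shift_act_deg n h')) /=.
    rewrite (linZ (b2 _ _ _ _)) scalerA sgnM; congr (_ *: _).
    by apply: (@sgn_par _ (- (n * a))); rewrite -hp mulrDr; lia.
- rewrite /ta /= cxdZ.
  have h1 : i + 1 + (j + n) = l + 1 + n by lia.
  have h2 : i + (j + 1 + n) = l + 1 + n by lia.
  have [_ b2 _] := tb (l + 1 + n).
  rewrite (dT _ _ _ _ _ _ _ erefl (shift_deg n erefl) (shift_deg n erefl) h1 h2) scalerDr.
  rewrite (linZ (b2 _ _ _ _)) !scalerA !sgnM.
  congr (_ *: _ + _ *: _); [exact: (pairingI tau)| |exact: (pairingI tau)].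
  by apply: (@sgn_par _ (- n)); rewrite mulrDr; lia.
- pose ph i j (h : i + j = l + n) (x : X i) (p : P j) : W :=
    sgn k (n * (j - n)) *: phi i (j - n) (shift_deg' h) x (cast (esym (subrK n j)) p).
  have [b1 b2 b3] := bphi.
  have phE i j j' (ej : j' + n = j) h h' x (p : P j) :
      ph i j h x p = sgn k (n * j') *: phi i j' h' x (cast (esym ej) p).
    have ej' : j' = j - n by lia.
    by subst j'; rewrite /ph (eq_irrelevance h' (shift_deg' h)) (castI _ (esym ej)).
  have bph : balanced ph.
    split=> [i j h p c x y|i j h x c p q|i a j ia aj hx hp h h' x r p]; rewrite /ph.
    + by rewrite b1 scalerDr !scalerA mulrC.
    + by rewrite cast_lin b2 scalerDr !scalerA mulrC.
    + have hp' : a + (j - n) = aj - n by lia.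
      rewrite (b3 _ _ _ _ _ hx hp' _ (shift_deg' h')) /=.
      rewrite (linZ (b2 _ _ _ _)) scalerA sgnM.
      rewrite (cast_act _ _ (etrans hp (esym (subrK n aj)))).
      rewrite (act_castr _ _ (etrans hp (esym (subrK n aj)))).
      by congr (sgn k _ *: _); rewrite -hp' [n * (a + _)]mulrDr addrC.
  have [g lg eg] := tensor_rec tT bph; exists g => // i j h x p.
  rewrite /ta (linZ lg) eg (phE _ _ j erefl _ h) sgnK.
  by [].
- apply: (tensor_ext tT lg) => [c x y|i j h x p]; first by rewrite scaler0 addr0.
  have [j' ej] : exists j', j = j' + n by exists (j - n); rewrite subrK.
  subst j; have h' : i + j' = l by lia.
  have := e i j' h' x p; rewrite /ta (linZ lg) (pairingI tau _ h) => e0.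
  by rewrite -[LHS](@sgnK _ _ (n * j')) e0 scaler0.
Qed.

(** The sign of [x] appears in the first component because [P] occurs suspended
    in the cone. *)
Lemma tensor_cone P Q T U (tau : pairing P T) (ups : pairing Q U) (f : dgmor P Q)
    (F : cx_mor T U) :
  tensor_by tau -> tensor_by ups ->
  (forall l i j h x p, F l (tau l i j h x p) = ups l i j h x (f j p)) ->
  is_tensor X (cone f) (cx_cone F).
Proof.
move=> tT tU eF; apply/is_tensorE; case: (tT) => tb dT _; case: (tU) => ub dU _.
pose ta : pairing (cone f) (cx_cone F) := fun l i j h x p =>
  (sgn k i *: tau (l + 1) i (j + 1) (degAS h) x p.1, ups l i j h x p.2).
exists ta; apply: tensor_mk => [l|i j l h x [p q]|l W phi [b1 b2 b3]|l W g lg e [t t']].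
- have [b1 b2 b3] := tb (l + 1); have [c1 c2 c3] := ub l.
  split=> [i j h p c x y|i j h x c p q|i a j ia aj hx hp h h' x r p]; rewrite /ta /=.
  + congr (_, _); last exact: c1.
    by rewrite /= b1 scalerDr !scalerA mulrC.
  + congr (_, _); last exact: c2.
    by rewrite /= b2 scalerDr !scalerA mulrC.
  + congr (_, _); last exact: c3.
    rewrite (b3 _ _ _ _ _ hx (degAS hp) _ (degAS h')) (linZ (b2 _ _ _ _)) scalerA.
    by rewrite (sgnD k hx).
- have [b1 b2 b3] := tb (l + 1 + 1); have [c1 c2 c3] := ub (l + 1).
  rewrite {1}/ta cx_cone_d cone_d /ta /= cxdZ cx_morZ eF.
  have h1 : i + 1 + (j + 1) = l + 1 + 1 by lia.
  have h2 : i + 1 + j = l + 1 by lia.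
  rewrite (dT _ _ _ _ _ _ _ erefl erefl erefl h1 (degAS (degAS h))).
  rewrite (dU _ _ _ _ _ _ h erefl erefl erefl h2 (degAS h)).
  congr (_, _); rewrite /=.
    rewrite (pairingI tau _ h1) (linN (b2 _ _ _ _)) scalerDr !sgnK opprD.
    by rewrite (sgnS k (erefl (i + 1))) scaleNr.
  rewrite (pairingI ups _ h2) (linD (c2 _ _ _ _)) scalerDr.
  by rewrite [LHS]addrCA (pairingI ups _ (degAS h)).
- have e0 (j : int) : j = j - 1 + 1 by lia.
  have e1 (i j : int) : i + j = l + 1 -> i + (j - 1) = l by lia.
  pose ph1 i j (h : i + j = l + 1) (x : X i) (p : P j) : W :=
    sgn k i *: phi i (j - 1) (e1 i j h) x ((cast (e0 j) p, 0) : cone f (j - 1)).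
  pose ph2 i j (h : i + j = l) (x : X i) (q : Q j) : W :=
    phi i j h x ((0, q) : cone f j).
  have ph1E i j (h : i + (j + 1) = l + 1) h' x (p : P (j + 1)) :
      ph1 i (j + 1) h x p = sgn k i *: phi i j h' x ((p, 0) : cone f j).
    rewrite /ph1; move: (e1 i (j + 1) h) (e0 (j + 1)).
    have ej : j = j + 1 - 1 by lia.
    case: _ / ej => h1 h2.
    by rewrite (eq_irrelevance h1 h') (cast_id h2).
  have bph1 : balanced ph1.
    split=> [i j h p c x y|i j h x c p q|i a j ia aj hx hp h h' x r p]; rewrite /ph1.
    + by rewrite b1 scalerDr !scalerA mulrC.
    + have -> : (cast (e0 j) (c *: p + q), 0) = c *: ((cast (e0 j) p, 0) : cone f (j - 1))
          + ((cast (e0 j) q, 0) : cone f (j - 1)).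
        by congr (_, _); rewrite /= ?cast_lin // scaler0 addr0.
      by rewrite b2 scalerDr !scalerA mulrC.
    + have hp' : a + (j - 1) = aj - 1 by lia.
      rewrite (b3 _ _ _ _ _ hx hp' _ (e1 i aj h')) /= act0.
      rewrite (cast_act2 (e0 j) (e0 aj) hp (degAS hp')).
      have -> : ((sgn k a *: dgm_act (degAS hp') r (cast (e0 j) p), 0) : cone f (aj - 1)) =
         sgn k a *: ((dgm_act (degAS hp') r (cast (e0 j) p), 0) : cone f (aj - 1)).
        by congr (_, _); rewrite /= scaler0.
      by rewrite (linZ (b2 _ _ _ _)) scalerA (sgnD k hx) -mulrA sgnM sgn_double mulr1.
  have bph2 : balanced ph2.
    split=> [i j h p c x y|i j h x c p q|i a j ia aj hx hp h h' x r p]; rewrite /ph2.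
    + by rewrite b1.
    + have -> : (0, c *: p + q) = c *: ((0, p) : cone f j) + ((0, q) : cone f j).
        by congr (_, _); rewrite /= ?scaler0 ?addr0.
      by rewrite b2.
    + by rewrite (b3 _ _ _ _ _ hx hp _ h') /= act0 scaler0.
  have [g1 l1 eg1] := tensor_rec tT bph1; have [g2 l2 eg2] := tensor_rec tU bph2.
  exists (fun t => g1 t.1 + g2 t.2).
    by move=> c x y; rewrite /= l1 l2 scalerDr addrACA.
  move=> i j h x [p q]; rewrite /ta /= (linZ l1) eg1 eg2 (ph1E _ _ _ h) sgnK /ph2.
  rewrite -(linD (b2 _ _ _ _)); congr (phi i j h x _).
  by congr (_, _); rewrite /= ?addr0 ?add0r.
- have lg1 : linear (fun t : T (l + 1) => g (t, 0)).
    move=> c x y; rewrite -lg; congr g; congr (_, _); by rewrite /= scaler0 addr0.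
  have lg2 : linear (fun t : U l => g (0, t)).
    move=> c x y; rewrite -lg; congr g; congr (_, _); by rewrite /= scaler0 addr0.
  have -> : (t, t') = ((t, 0) : cx_cone F l) + ((0, t') : cx_cone F l).
    by congr (_, _); rewrite /= ?addr0 ?add0r.
  rewrite (linD lg).
  have -> : g (t, 0) = 0.
    apply: (tensor_ext tT lg1) => [c x y|i j h x p]; first by rewrite scaler0 addr0.
    have [j' ej] : exists j', j = j' + 1 by exists (j - 1); lia.
    subst j; have h' : i + j' = l by lia.
    have := e i j' h' x (p, 0); have [_ c2 _] := ub l.
    rewrite /ta /= (lin0 (c2 _ _ _ _)) (pairingI tau _ h) (linZ lg1) => e0.
    by rewrite -[LHS](@sgnK _ _ i) e0 scaler0.
  rewrite add0r; apply: (tensor_ext tU lg2) => [c x y|i j h x q].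
    by rewrite scaler0 addr0.
  have := e i j h x (0, q); have [_ c2 _] := tb (l + 1).
  by rewrite /ta /= (lin0 (c2 _ _ _ _)) scaler0.
Qed.

Lemma K_projective_shift n P : K_projective P -> K_projective (shift n P).
Proof. by move/K_projectiveP => o; apply/left_orth_K_projective/left_orth_shift/o. Qed.

Lemma K_projective_cone P Q (f : dgmor P Q) :
  K_projective P -> K_projective Q -> K_projective (cone f).
Proof.
move=> kP /K_projectiveP oQ; apply/K_projectiveP; apply: left_orth_cone => //.
exact/K_projectiveP/K_projective_shift.
Qed.

(** An acyclic K-projective module is contractible. *)
Lemma tensor_acyclic P T : K_projective P -> (forall j, exact_at P j) ->
  is_tensor X P T -> forall j, exact_at T j.
Proof.
move=> /K_projectiveP oP eP /is_tensorE[tau tT]; apply: (tensor_contractible tT).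
by apply: oP => j _.
Qed.

(** Two K-projective resolutions are related by a quasi-isomorphism [g].  The cone
    of [g] is K-projective and acyclic, so its tensor product, which is the
    cone of the map induced by [g], is exact. *)
Lemma dtensor_unique F M (psi : dgmor F M) T T1 : K_projective F -> quasi_iso psi ->
  is_tensor X F T -> is_dtensor X M T1 -> forall j, exact_at T j <-> exact_at T1 j.
Proof.
move=> kF qpsi /is_tensorE[tau tT] [P1 [q1 [kP1 qq1 /is_tensorE[tau1 tT1]]]] j.
have [|g hg] := left_orth_lift (q := q1) psi ((K_projectiveP F).1 kF).
  by move=> i _; exact: (qi_cone q1).1.
have qg := qi_left_cancel qpsi qq1 hg.
have [G eG] := tensor_map g tT tT1.
have eC := tensor_acyclic (K_projective_cone kF kP1) ((qi_cone g).1 qg)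
  (tensor_cone tT tT1 eG).
split=> [e|e]; first exact: les_target e (eC j).
have h : j - 1 + 1 = j by lia.
exact: les_source h (eC _) e.
Qed.
End Tensor.

(** * Suprema and top degrees *)

Section Sup.
Variable k : fieldType.
Implicit Types C D A B : complex k.

(** The supremum of the cohomology, when it is finite. *)
Definition top_degree C n := (forall j, n < j -> exact_at C j) /\ ~ exact_at C n.

Lemma cx_sup_ext C D : (forall j, exact_at C j <-> exact_at D j) -> cx_sup C = cx_sup D.
Proof.
move=> e; rewrite /cx_sup; congr supremum; apply/funext => t; apply/propext.
by split=> -[j /nexact_atP h ->]; exists j => //; apply/nexact_atP => /e.
Qed.

Lemma cx_sup_exact C : (forall j, exact_at C j) -> cx_sup C = -oo%E.
Proof.
move=> e; rewrite /cx_sup (_ : mkset _ = set0%classic) ?supremum0 //.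
by rewrite -subset0 => t [j /nexact_atP + _]; apply; apply: e.
Qed.

Lemma supremumE (A : set (\bar int)) x y :
  (A !=set0)%classic -> supremums A x -> supremum y A = x.
Proof.
move=> /set0P /negbTE A0 Ax; rewrite /supremum A0.
by case: xgetP => [z _ Az|/(_ x)//]; apply: is_subset1_supremums Az Ax.
Qed.

Lemma cx_sup_top C n : top_degree C n -> cx_sup C = n%:E.
Proof.
move=> [e /nexact_atP ne]; apply: supremumE; first by exists n%:E, n.
split=> [_ [j /nexact_atP nj ->]|y /(_ n%:E)]; last by apply; exists n.
by rewrite lee_fin leNgt; apply/negP => /e.
Qed.

(** A nonempty set of integers that is bounded above has a maximum. *)
Lemma cx_sup_cases C :
  (cx_sup C < +oo)%E -> (forall j, exact_at C j) \/ exists n, top_degree C n.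
Proof.
move=> supC; have [ex|nt] := pselect (exists n, top_degree C n); first by right.
left => j0; apply: contrapT => nj0.
suff e : cx_sup C = +oo%E by rewrite e ltxx in supC.
apply: supremumE; first by exists j0%:E, j0 => //; apply/nexact_atP.
split=> [y _|y uy]; first exact: leey.
have uj j : ~ exact_at C j -> (j%:E <= y)%E.
  by move=> nj; apply: uy; exists j => //; apply/nexact_atP.
case: y uj {uy} => [r||] uj //; last by have := uj _ nj0; rewrite leeNy_eq.
case: nt; have [m em] : exists m : nat, j0 + m%:Z > r by exists (absz (r - j0 + 1)); lia.
elim: m j0 em nj0 => [|m IH] j0 em nj0.
  by have := uj _ nj0; rewrite lee_fin; lia.
have [ea|] := pselect (forall j, j0 < j -> exact_at C j); first by exists j0.
move=> /existsNP[j1 /not_implyP[j01 nj1]].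
by apply: (IH j1) => //; lia.
Qed.

(** The top class of [A] survives in the cone, as nothing in [B] can hit it. *)
Lemma top_degree_cone A B (f : cx_mor A B) n :
  top_degree A (n + 1) -> (forall j, n < j -> exact_at B j) -> top_degree (cx_cone f) n.
Proof.
move=> [eA nA] eB; split=> [j nj|e].
  by apply: (@les_cone _ _ _ f j _ erefl); [apply: eB|apply: eA; lia].
by apply: nA; apply: (@les_source _ _ _ f n _ erefl e); apply: eB; lia.
Qed.

Lemma top_cx_shift C n m : top_degree C n <-> top_degree (cx_shift m C) (n - m).
Proof.
rewrite /top_degree exact_cx_shift subrK; split=> -[e ne]; split=> // j nj.
  by apply/exact_cx_shift/e; lia.
by rewrite -[j](subrK m); apply/exact_cx_shift/e; lia.
Qed.
End Sup.

(** * Morphisms out of the zero module and of R; R as a right module *)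

Section Zero.
Variables (k : fieldType) (R : dgAlg k) (M : dgmod R).
Program Definition from_zero : dgmor (zero_mod R) M :=
  @DGMor k R (zero_mod R) M (fun j x => 0) _ _ _.
Next Obligation. by move=> j c x y; rewrite scaler0 addr0. Qed.
Next Obligation. by move=> i j h x; rewrite cxd0. Qed.
Next Obligation. by move=> i j l h r x; rewrite act0. Qed.

Variables (z : M 0) (cz : cocycle z).
Program Definition from_regular : dgmor (regular R) M :=
  @DGMor k R (regular R) M (fun j x => dgm_act (addr0 j) (x : R j) z) _ _ _.
Next Obligation. by move=> j c x y; rewrite dgm_act_linl. Qed.
Next Obligation.
move=> i j h x /=; have h0 : 0 + 1 = 1 :> int by [].
have h2 : i + 1 = j by [].
rewrite (dgm_leibniz (addr0 i) h h0 h (addr0 j) h2) cz act0 scaler0 addr0.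
by [].
Qed.
Next Obligation. by move=> i j l h r x /=; rewrite (dgm_actA h _ (addr0 j) h). Qed.

Lemma from_regular1 : from_regular 0 (dga_one R) = z.
Proof. exact: dgm_act1. Qed.
End Zero.

Section RegularRight.
Variables (k : fieldType) (R : dgAlg k).

(** Tensoring with [R] itself makes the supremum of a module an instance of the
    supremum of a tensor product. *)
Definition rregular : rdgmod R :=
  RDGMod (@dga_mul_linl _ R) (@dga_mul_linr _ R) (@dga_mulA _ R)
    (@dga_mul1r _ R) (@dga_leibniz _ R).

Lemma tensor_rregular (P : dgmod R) : is_tensor rregular P P.
Proof.
pose tau : pairing rregular P P := fun l i j h (x : R i) p => dgm_act h x p.
apply/is_tensorE; exists tau.
apply: tensor_mk => [l|i j l h x p|l W phi [b1 b2 b3]|l W g lg e t].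
- split=> [i j h p|i j h x|i a j ia aj hx hp h h' x r p].
  + exact: dgm_act_linl.
  + exact: dgm_act_linr.
  + exact: dgm_actA.
- exact: dgm_leibniz.
- exists (phi 0 l (add0r l) (dga_one R)); first exact: b2.
  move=> i j h x p; rewrite -(b3 _ _ _ _ _ (add0r i) h h (add0r l)) /=.
  by rewrite dga_mul1l.
- by rewrite -(dgm_act1 (add0r l) t) (e _ _ (add0r l)).
Qed.
End RegularRight.

(** * The two formulas *)

Section Main.
Variables (k : fieldType) (R : scDGA k).
Implicit Types F G M P X : dgmod R.

Lemma cohom_small_R : cohom_small R.
Proof.
split=> [j|]; first exact/cohom_findim_fg/dga_findim.
by exists 0 => j j0; apply: exact_at0 => x; apply: dga_neg.
Qed.

Lemma attach_K_projective F ds G (i : dgmor F G) :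
  attach ds i -> K_projective F -> K_projective G.
Proof.
by move=> a /K_projectiveP oF; apply/K_projectiveP/(attach_left_orth a oF).
Qed.

Lemma attach_nil F ds G (i : dgmor F G) : attach ds i -> ds = [::] ->
  (forall j, exact_at F j) -> forall j, exact_at G j.
Proof. by case. Qed.

(** The tensor product is built along with the module, and its top degree is
    that of the last cone, by [top_degree_cone].  The bound [d0] is the degree of
    the previous generator; the disjunction covers the two ways to start the
    induction, from a module whose top degree is known or from the first generator. *)
Lemma attach_tensor (X : rdgmod R) F ds G (i : dgmor F G) T : attach ds i ->
  is_tensor X F T ->
  exists2 T', is_tensor X G T' & forall t d0, top_degree X t ->
    (forall j, d0 + t < j -> exact_at T j) -> {in ds, forall d, d0 <= d} ->
    nondecreasing_degrees ds ->
    top_degree T (d0 + t) \/ ds <> [::] -> top_degree T' (last d0 ds + t).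
Proof.
move=> a; elim: a T => {F ds G i} [F i e|F d f ds G i i1 a IH e1] T tT.
  by exists T => // t d0 _ _ _ _ [].
have tX : is_tensor X (free_mod R (d + 1)) (cx_shift (- (d + 1)) X).
  exact/tensor_shift/tensor_regular.
have [tau htau] := (is_tensorE X F T).1 tT.
have [ta hta] := (is_tensorE _ _ _).1 tX.
have [Tf eTf] := tensor_map f hta htau.
have [T' tT' hT'] := IH _ (tensor_cone hta htau eTf).
exists T' => // t d0 tpX eT hds sds _ /=.
have topc : top_degree (cx_cone Tf) (d + t).
  apply: top_degree_cone; last first.
    by move=> j dj; apply: eT; have := hds d (mem_head _ _); lia.
  have := (top_cx_shift X t (- (d + 1))).1 tpX.
  by rewrite (_ : t - _ = d + t + 1) //; lia.
move: sds => /andP[dds sds].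
apply: (hT' t d tpX topc.1 _ sds); last by left.
by move=> x xs; have /allP := dds; apply.
Qed.

Lemma k_exact j : j != 0 -> exact_at (k_cx k) j.
Proof.
by move=> j0; apply: exact_at0 => x; rewrite -(kvalK x) kvalN.
Qed.

Lemma top_degree_k : top_degree (k_cx k) 0.
Proof.
split=> [j j0|e]; first by apply: k_exact; lia.
have [//|i [h [y]]] := e (@kinc k 0 1) => /(congr1 (@kval k 0)).
rewrite kval_inc eqxx (lin0 (@kval_lin k 0)) => /eqP.
by rewrite eq_sym oner_eq0.
Qed.

Lemma dtensor_exact (X : rdgmod R) M F (psi : dgmor F M) T : K_projective F -> quasi_iso psi ->
  is_tensor X F T -> forall j, exact_at T j <-> exact_at (dtensor X M) j.
Proof.
move=> kF qpsi tT; apply: (dtensor_unique kF qpsi tT).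
apply: (@epsilon_spec _ _ (is_dtensor X M)).
by exists T, F, psi.
Qed.

(** Cohomology bounded below makes [0 -> M] an isomorphism in low degrees. *)
Lemma resolve_from_zero M : Dc M -> exists ds F (i : dgmor (zero_mod R) F) (psi : dgmor F M),
  [/\ attach ds i, nondecreasing_degrees ds, K_projective F & quasi_iso psi].
Proof.
move=> DM; have [hM _] := Dc_small_bounded cohom_small_R DM.
have [hf [a ea]] := hM.
have [||ds [G [i [psi [a1 a2 _ _ a3]]]]] :=
    @resolve_compact _ _ _ _ (from_zero M) (a - 1) cohom_small_R _ _ (@left_orth_zero _ R _) DM.
- move=> j ja; apply: (@les_cone _ _ _ (cx_mor_of (from_zero M)) j _ erefl).
    by apply: ea; lia.
  exact: zero_exact.
- by split=> [j|]; [apply: exact_cohom_fg|exists 0 => j _]; apply: zero_exact.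
exists ds, G, i, psi; split=> //.
apply: (attach_K_projective a1).
exact: left_orth_K_projective (@left_orth_zero _ R (fun _ => True)).
Qed.

Lemma top_degree_ext (C D : complex k) n :
  (forall j, exact_at C j <-> exact_at D j) -> top_degree C n -> top_degree D n.
Proof. by move=> e [h nh]; split=> [j /h /e|/e]. Qed.

Lemma pcdE M F (psi : dgmor F M) T : K_projective F -> quasi_iso psi ->
  is_tensor (k_right R) F T -> pcd M = cx_sup T.
Proof.
by move=> kF qpsi tT; apply/esym/cx_sup_ext/(dtensor_exact kF qpsi tT).
Qed.

(** The unit is not a coboundary, since [R] vanishes in degree [-1]. *)
Lemma nexact_R0 : ~ exact_at R 0.
Proof.
move=> /(_ _ (@cocycle1 _ R)) [i [h [y]]].
have i0 : i < 0 by lia.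
rewrite (dga_neg i0 y) cxd0 => /(congr1 (@aug _ R 0)).
by rewrite aug1 aug0 => /eqP; rewrite eq_sym oner_eq0.
Qed.

Lemma pcd_acyclic M : Dc M -> (forall j, exact_at M j) -> pcd M = -oo%E.
Proof.
move=> DM eM; have [ds [F [i [psi [a _ kF qpsi]]]]] := resolve_from_zero DM.
have [T tT _] := attach_tensor a (tensor_zero (k_right R)).
rewrite (pcdE kF qpsi tT); apply: cx_sup_exact.
by apply: tensor_acyclic tT => // j; apply/(qi_exact _ qpsi).
Qed.

Lemma sup_eq_pcd_add M s : Dc M -> ~ (forall j, exact_at M j) -> top_degree R s ->
  exists p, top_degree M (p + s) /\ pcd M = p%:E.
Proof.
move=> DM nM topR; have [ds [F [i [psi [a sds kF qpsi]]]]] := resolve_from_zero DM.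
have [T tT hT] := attach_tensor a (tensor_zero (k_right R)).
have [U tU hU] := attach_tensor a (tensor_zero (rregular R)).
have dsn : ds <> [::].
  move=> /(attach_nil a) e; apply: nM => j; apply/(qi_exact j qpsi)/e => {}j.
  exact: zero_exact.
have [d ed] : exists d, {in ds, forall x, d <= x}.
  case: ds sds dsn {a hT hU} => // d ds /andP[/allP h _] _; exists d => x.
  by rewrite inE => /orP[/eqP->//|/h].
exists (last d ds); split.
  have tp : top_degree U (last d ds + s).
    apply: (hU s d) => //; last by right.
    by move=> j _; apply: (@zero_exact _ R).
  apply: top_degree_ext tp => j; rewrite -(qi_exact j qpsi).
  apply: (dtensor_unique kF (qi_id F) tU).
  by exists F, (id_mor F); split=> //; [exact: qi_id|exact: tensor_rregular].
rewrite (pcdE kF qpsi tT) -[last d ds]addr0; apply: cx_sup_top.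
apply: (hT 0 d) => //; [exact: top_degree_k| |by right].
by move=> j _; apply: (@zero_exact _ R).
Qed.

(** The first formula; [sup R >= 0], so [sup R] is an integer. *)
Lemma pcd_eq_sup_sub M : Dc M -> (cx_sup R < +oo -> pcd M = cx_sup M - cx_sup R)%E.
Proof.
move=> DM /cx_sup_cases[e|[s topR]]; first by case: nexact_R0.
rewrite (cx_sup_top topR).
have [eM|nM] := pselect (forall j, exact_at M j).
  by rewrite pcd_acyclic // cx_sup_exact.
have [p [tM ->]] := sup_eq_pcd_add DM nM topR.
by rewrite (cx_sup_top tM) -EFinB addrK.
Qed.

Section Residue.
Hypothesis Dk : Dc (k_left R).

(** The resolution of [k] can start from [R -> k], whose cone is exact in
    degrees [<= 0] because [R^1 = 0]. *)
Lemma resolve_k : exists ds K (i : dgmor (regular R) K) (psi : dgmor K (k_left R)),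
  [/\ attach ds i, nondecreasing_degrees ds, {in ds, forall d, 0 < d},
     K_projective K & quasi_iso psi] /\
  psi 0 (i 0 (dga_one R)) = kinc 0 1.
Proof.
have ck : cocycle (kinc 0 1 : k_left R 0) by [].
pose phi := from_regular ck.
have R0 (x : R 0) : phi 0 x = 0 -> x = 0.
  move=> h; have : @kval k 0 (kinc 0 (aug x * kval (@kinc k 0 1))) = 0.
    exact: (etrans (congr1 (@kval k 0) h) (lin0 (@kval_lin k 0))).
  by rewrite !kval_inc eqxx mulr1 => a0; rewrite (augK x) a0 scale0r.
have k0 j (v : k_left R j) : j != 0 -> v = 0.
  by move=> j0; rewrite -(kvalK v) kvalN //; exact: (lin0 (@kinc_lin k j)).
have eC j : j <= 0 -> exact_at (cone phi) j.
  rewrite le_eqVlt => /orP[/eqP->|]; last first.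
    have [->|jn j0] := eqVneq j (-1).
      move=> _ [x v] /cone_cocycle[_]; rewrite addr0 => /R0 ->.
      by rewrite (k0 _ v) //; exact: (coboundary_subspace (cone phi) (-1)).1.
    apply: exact_at0 => -[x v]; rewrite (k0 _ v); last by lia.
    by rewrite (R_small x) //; left; lia.
  move=> [x v] _; rewrite (R_small x); last by right.
  apply/(coboundaryE (erefl : -1 + 1 = 0 :> int)); exists (kval v *: dga_one R, 0).
  rewrite /= /cone_map /=.
  congr (_, _); first by apply: R_small; right.
  rewrite addr0 kval_inc eqxx mulr1 linearZ /= dga_R0_one /GRing.scale /= mulr1.
  exact: (kvalK v).
have [||ds [G [i [psi [a1 a2 a3 a4 a5]]]]] :=
    @resolve_compact _ _ _ _ phi 0 cohom_small_R _ _
      (@left_orth_regular _ R (fun j => j <= 0) (lexx 0)) Dk.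
- exact: eC.
- exact: cohom_small_R.
exists ds, G, i, psi; split; last first.
  by rewrite a4; exact: (from_regular1 ck).
split=> //; apply: (attach_K_projective a1); apply: left_orth_K_projective.
exact: (@left_orth_regular _ R (fun j => True)).
Qed.

(** Here [K] is the resolution of [k], and [c] below is [pcd k]. *)
Section Kill.
Variables (ds : seq int) (K : dgmod R) (i : dgmor (regular R) K) (psi : dgmor K (k_left R)).
Hypotheses (a : attach ds i) (ds0 : {in ds, forall d, 0 < d})
  (kK : K_projective K) (qpsi : quasi_iso psi) (psi1 : psi 0 (i 0 (dga_one R)) = kinc 0 1).

Let u : K 0 := i 0 (dga_one R).

Lemma unit_K_cocycle : cocycle u.
Proof. by apply: mor_cocycle; apply: cocycle1. Qed.

Lemma K_exact j : j != 0 -> exact_at K j.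
Proof.
move=> j0; apply/(qi_exact j qpsi); exact: k_exact.
Qed.

(** The cohomology of [K] is that of [k], with [u] as generator in degree [0]. *)
Lemma K_cohom0 (b : K 0) : cocycle b -> exists c, coboundary (b - c *: u).
Proof.
move=> cb; have [inj _] := qpsi 0; exists (@kval k 0 (psi 0 b)); apply: inj.
  apply: (subspaceB (cocycle_subspace _ _) cb); apply: (subspaceZ _ (cocycle_subspace _ _)).
  exact: unit_K_cocycle.
rewrite morB morZ psi1.
suff -> : psi 0 b - @kval k 0 (psi 0 b) *: (kinc 0 1 : k_left R 0) = 0.
  exact: (coboundary_subspace _ _).1.
apply/eqP; rewrite subr_eq0 -{1}[psi 0 b]kvalK.
rewrite -(linZ (@kinc_lin k 0)) /GRing.scale /= mulr1.
by [].
Qed.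

Lemma kill_map X (z : X 0) : (forall j, 1 < j -> exact_at X j) -> cocycle z ->
  exists f : dgmor K X, f 0 u = z.
Proof.
move=> eX cz; have [|f hf] := attach_extend (from_regular cz) a.
  by move=> d /ds0 d0; apply: eX; lia.
by exists f; rewrite hf; apply: from_regular1.
Qed.

Section KillFacts.
Variables (X : dgmod R) (z : X 0) (cz : cocycle z) (f : dgmor K X) (fu : f 0 u = z).

Lemma kill_exact j : j != -1 -> exact_at X j -> exact_at (cone f) j.
Proof.
move=> j1 eX; apply: (@les_cone _ _ _ (cx_mor_of f) j _ erefl) => //.
by apply: K_exact; lia.
Qed.

(** The connecting map from the cohomology of [K] in degree [0] sends the
    generator to the class of [z], so it is injective. *)
Lemma kill_exactN1 : ~ coboundary z -> exact_at X (-1) -> exact_at (cone f) (-1).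
Proof.
move=> nz eX; apply: (@les_cone_inj _ _ _ (cx_mor_of f) (-1) 0) => // b cb /= bfb.
have [c hc] := K_cohom0 cb.
have [c0|c0] := eqVneq c 0; first by move: hc; rewrite c0 scale0r subr0.
case: nz; rewrite -(scale1r z) -(mulVf c0) -scalerA.
apply: (subspaceZ _ (coboundary_subspace _ _)).
have -> : c *: z = f 0 b - f 0 (b - c *: u) by rewrite morB morZ fu opprB addrC subrK.
by apply: (subspaceB (coboundary_subspace _ _) bfb); apply: mor_coboundary.
Qed.

Lemma kill_span s : spans_cohom (z :: s) -> spans_cohom (map (cone_in f 0) s).
Proof.
move=> [cs hs]; split=> [v /mapP[x xs ->]|w cw].
  by apply: mor_cocycle; apply: cs; rewrite inE xs orbT.
have e1 : exact_at K 1 by apply: K_exact.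
have [b cb hb] := @cx_cone_lift _ _ _ (cx_mor_of f) 0 1 erefl e1 w cw.
have sC := coboundary_subspace (cone f) 0.
rewrite -[w](subrK (cone_in f 0 b)).
apply: (subspaceD (span_subspace _ sC)); first exact: (span_base _ sC).
have [c hc] := hs b cb; rewrite -[b](subrK (c *: z)) morD morZ.
apply: (subspaceD (span_subspace _ sC)).
  by apply: span_map hc; [exact: mor_lin|move=> x; apply: mor_coboundary].
apply: (span_base _ sC); apply: (subspaceZ _ sC); rewrite -fu.
exact: (@cx_cone_kills _ _ _ (cx_mor_of f) 0 u unit_K_cocycle).
Qed.

End KillFacts.

Lemma K_cohom_small : cohom_small K.
Proof. by apply: (attach_cohom_small cohom_small_R a); apply: cohom_small_R. Qed.

Variables (Tk : complex k) (c : int).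
Hypotheses (tK : is_tensor (k_right R) K Tk) (topk : top_degree Tk c).

Lemma cone_tensor X T (f : dgmor K X) : is_tensor (k_right R) X T ->
  exists g : cx_mor Tk T, is_tensor (k_right R) (cone f) (cx_cone g).
Proof.
move=> /is_tensorE[ta hta]; have [tau htau] := (is_tensorE _ _ _).1 tK.
have [g eg] := tensor_map f htau hta; exists g.
exact: tensor_cone htau hta eg.
Qed.

(** Induction on the amplitude [n], then on the number of classes that span the top
    cohomology of [X].  Killing one class replaces [X] by a cone, and [K] has
    nothing above [c] after tensoring.  When no class is left in degree [0],
    [X] is shifted so as to have top degree [0] again. *)
Lemma tensor_exact_above (n : nat) X T : K_projective X -> is_tensor (k_right R) X T ->
  (forall j, cohom_fg X j) -> (forall j, 0 < j -> exact_at X j) ->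
  (forall j, j <= - n%:Z -> exact_at X j) -> forall j, c < j -> exact_at T j.
Proof.
elim: n X T => [|n IH] X T kX tX hX e1 e2.
  move=> j _; apply: (tensor_acyclic kX _ tX) => {}j.
  by case: (ltP 0 j) => [/e1|/e2].
have [s] := hX 0; have [m] := ubnP (size s).
elim: m X T kX tX hX e1 e2 s => // m IHm X T kX tX hX e1 e2 [|z s] hm hs j cj.
  (* The cohomology in degree [0] vanishes as well: shift up by one. *)
  have := IH _ _ (K_projective_shift (n := -1) kX) (tensor_shift (-1) tX) _ _ _ (j + 1).
  rewrite exact_cx_shift addrK; apply; last by lia.
  - by move=> l; apply/cohom_fg_shift.
  - move=> l l0; apply/exact_shift.
    have [->|l1] := eqVneq l 1; first by move=> x /hs.2.
    by apply: e1; lia.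
  - by move=> l ln; apply/exact_shift/e2; lia.
have [bz|nz] := pselect (coboundary z).
  exact: (IHm X T kX tX hX e1 e2 s _ (spans_cohom_drop bz hs)).
have cz : cocycle z by apply: hs.1; apply: mem_head.
have [|f fz] := kill_map _ cz; first by move=> l l1; apply: e1; lia.
have [g tg] := cone_tensor f tX.
have eC : exact_at (cx_cone g) j.
  apply: (IHm _ _ (K_projective_cone kK kX) tg _ _ _ _ _ (kill_span fz hs)) => //.
  - by move=> l; have := cohom_fg_cone (cx_mor_of f) (erefl (l + 1)) (hX l) (K_cohom_small.1 _).
  - by move=> l l0; apply: kill_exact; [lia|apply: e1].
  - move=> l ln; have [l1|l1] := eqVneq l (-1).
      by subst l; apply: (kill_exactN1 fz nz); apply: e2.
    by apply: kill_exact => //; apply: e2.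
  - by rewrite size_map.
by apply: les_target eC; apply: topk.1.
Qed.

(** The case where there is no cohomology in degree [-1].  Exactness of [T] in degree
    [c] is inherited by the cones that kill the classes of degree [0].  The last
    of these cones is exact in degrees [>= -1], so it does not contribute in
    degree [c - 1]; the class of degree [c] of [K] would then have to vanish. *)
Lemma tensor_top_gap X T : K_projective X -> is_tensor (k_right R) X T -> cohom_small X ->
  (forall j, 0 < j -> exact_at X j) -> exact_at X (-1) -> exact_at T c -> exact_at X 0.
Proof.
move=> kX tX hX e1 e2 eT; have [s] := hX.1 0; have [m] := ubnP (size s).
elim: m X T kX tX hX e1 e2 eT s => // m IHm X T kX tX hX e1 e2 eT [|z s] hm hs.
  exact: hs.2.
have [bz|nz] := pselect (coboundary z).
  exact: (IHm X T kX tX hX e1 e2 eT s _ (spans_cohom_drop bz hs)).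
have cz : cocycle z by apply: hs.1; apply: mem_head.
have [|f fz] := kill_map _ cz; first by move=> l l1; apply: e1; lia.
have [g tg] := cone_tensor f tX.
have kC : K_projective (cone f) := K_projective_cone kK kX.
have hC : cohom_small (cone f) by apply: cohom_small_cone => //; apply: K_cohom_small.
have eC1 l : 0 < l -> exact_at (cone f) l.
  by move=> l0; apply: kill_exact; [lia|apply: e1].
have eCN := kill_exactN1 fz nz e2.
have eC0 : exact_at (cone f) 0.
  apply: (IHm _ _ kC tg hC eC1 eCN _ _ _ (kill_span fz hs)); last by rewrite size_map.
  by apply: (@les_cone _ _ _ g c _ erefl eT); apply: topk.1; lia.
case: topk => _ [].
have h : c - 1 + 1 = c by lia.
apply: (les_source h _ eT).
have [_ [b eb]] := hC.
(* The cone, shifted by [-2], has top degree at most [0]. *)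
have := @tensor_exact_above (absz (1 + b)) _ _ (K_projective_shift (n := -2) kC)
  (tensor_shift (-2) tg) _ _ _ (c + 1).
rewrite exact_cx_shift (_ : c + 1 + -2 = c - 1); last by lia.
apply; last by lia.
- by move=> l; apply/cohom_fg_shift; apply: hC.1.
- move=> l l0; apply/exact_shift.
  have [->|l1] := eqVneq l 1; first exact: eCN.
  have [->|l2] := eqVneq l 2; first exact: eC0.
  by apply: eC1; lia.
- by move=> l lb; apply/exact_shift/eb; lia.
Qed.

(** The classes of degree [-1] are killed first, by morphisms from [K] to [shift (-1) X]:
    they exist although the latter has cohomology in degree [1], since the
    generators of [K] other than [u] have degree at least [1] and meet obstructions
    in degrees [>= 2] only. *)
Lemma tensor_top X T : K_projective X -> is_tensor (k_right R) X T -> cohom_small X ->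
  (forall j, 0 < j -> exact_at X j) -> exact_at T c -> exact_at X 0.
Proof.
move=> kX tX hX e1 eT.
(* [Y] is [X] shifted so that the degrees [-1] and [0] become [0] and [1]. *)
suff H Y U : K_projective Y -> is_tensor (k_right R) Y U -> cohom_small Y ->
    (forall j, 1 < j -> exact_at Y j) -> exact_at U (c + 1) -> exact_at Y 1.
  have := H _ _ (K_projective_shift (n := -1) kX) (tensor_shift (-1) tX).
  rewrite exact_cx_shift exact_shift addrK; apply=> //; first exact: cohom_small_shift.
  by move=> j j1; apply/exact_shift/e1; lia.
move=> {kX tX hX e1 eT X T} kX tX hX e1 eT.
have [s] := hX.1 0; have [m] := ubnP (size s).
elim: m Y U kX tX hX e1 eT s => // m IHm X T kX tX hX e1 eT [|z s] hm hs.
  have := tensor_top_gap (K_projective_shift (n := 1) kX) (tensor_shift 1 tX)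
    (cohom_small_shift 1 hX).
  rewrite exact_cx_shift !exact_shift; apply=> //; last exact: hs.2.
  by move=> j j0; apply/exact_shift/e1; lia.
have cz : cocycle z by apply: hs.1; apply: mem_head.
have [f fz] := kill_map e1 cz.
have [g tg] := cone_tensor f tX.
have kC : K_projective (cone f) := K_projective_cone kK kX.
have hC : cohom_small (cone f) by apply: cohom_small_cone => //; apply: K_cohom_small.
have eC1 l : 1 < l -> exact_at (cone f) l.
  by move=> l0; apply: kill_exact; [lia|apply: e1].
apply: (@les_target _ _ _ (cx_mor_of f) 1); first exact: K_exact.
apply: (IHm _ _ kC tg hC eC1 _ _ _ (kill_span fz hs)); last by rewrite size_map.
by apply: (@les_cone _ _ _ g (c + 1) _ erefl eT); apply: topk.1; lia.
Qed.

End Kill.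

(** The second formula; [s] is the top degree of [M], and [shift s F] has top degree [0]. *)
Lemma pcd_eq_sup_add M : Dc M -> (cx_sup M < +oo -> pcd M = cx_sup M + pcd (k_left R))%E.
Proof.
move=> DM /cx_sup_cases[eM|[s topM]].
  by rewrite pcd_acyclic // cx_sup_exact.
have [ds [K [i [psi [[a sds ds0 kK qpsi] psi1]]]]] := resolve_k.
have [Tk tK hTk] := attach_tensor a (tensor_regular (k_right R)).
have topk : top_degree Tk (last 0 ds).
  rewrite -[last _ _]addr0.
  apply: (hTk 0 0 top_degree_k); [exact: top_degree_k.1| |exact: sds|].
    by move=> d /ds0 /ltW.
  by left; exact: top_degree_k.
rewrite (pcdE kK qpsi tK) (cx_sup_top topk) (cx_sup_top topM).
have [es [F [i' [phi [a' _ kF qphi]]]]] := resolve_from_zero DM.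
have [T tT _] := attach_tensor a' (tensor_zero (k_right R)).
have hF : cohom_small F by apply/(cohom_small_qi qphi); case: (Dc_small_bounded cohom_small_R DM).
have kS := K_projective_shift (n := s) kF; have tS := tensor_shift s tT.
have hS : cohom_small (shift s F) by apply: cohom_small_shift.
have e0 j : 0 < j -> exact_at (shift s F) j.
  by move=> j0; apply/exact_shift/(qi_exact _ qphi)/topM.1; lia.
have [_ [b eb]] := hS.
rewrite (pcdE kF qphi tT) -EFinD; apply: cx_sup_top; split=> [j jc|eT].
  have := @tensor_exact_above ds K i psi a ds0 kK qpsi psi1 _ _ tK topk (absz (b - 1))
    _ _ kS tS hS.1 e0 _ (j - s).
  rewrite exact_cx_shift subrK; apply; last by lia.
  by move=> l lb; apply: eb; lia.
apply: topM.2; apply/(qi_exact _ qphi).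
have := @tensor_top ds K i psi a ds0 kK qpsi psi1 _ _ tK topk _ _ kS tS hS e0.
by rewrite exact_cx_shift exact_shift add0r addrC; apply.
Qed.

End Residue.
End Main.

Local Open Scope ereal_scope.

Theorem corollary4p7 (k : fieldType) (R : scDGA k) (M : dgmod R) (HM : Dc M) :
  (cx_sup R < +oo -> pcd M = cx_sup M - cx_sup R) /\
  (cx_sup M < +oo -> Dc (k_left R) -> pcd M = cx_sup M + pcd (k_left R)).
Proof.
split; first exact: pcd_eq_sup_sub.
by move=> supM Dk; apply: pcd_eq_sup_add.
Qed.
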